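(* Let $p,q,r\in(0,1)$ with $p+q+r=1$. Let $X_1,\eta_2,\eta_3,\ldots$ be independent random variables, each taking the values $1,-1,0$ with probabilities $p,q,r$ respectively, and let $K_3,K_4,\ldots$ be independent random variables, independent of the previous ones, with $K_{n+1}$ uniformly distributed on $\{1,n\}$. Set $X_2=\eta_2X_1$, $X_{n+1}=\eta_{n+1}X_{K_{n+1}}$ for $n\ge2$, and $S_n=\sum_{k=1}^nX_k$. Let $T_n$ denote the partial sums of the same construction with $X_1$ replaced by the constant $1$, and let $\sigma_T^2=\lim_{n\to\infty}\operatorname{Var}(T_n)/n$ (this limit exists). Then, as $n\to\infty$, $\dfrac{S_n-n\frac{(p-q)X_1}{2+q-p}}{\sqrt n}$ converges in distribution to the mixture $(p+q)\mathcal N_{0,\sigma_T^2}+r\delta_0$, i.e. to the law with distribution function $F(x)=(p+q)G(x)+r\,\mathbf 1\{x\ge0\}$, where $G$ is the distribution function of the normal law with mean $0$ and variance $\sigma_T^2$.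
   Context: This is the elephant random walk with delays in which the elephant remembers only the first step and the most recent step: step $n+1$ ($n\ge2$) picks one of $X_1,X_n$ uniformly at random and repeats it (probability $p$), reverses it (probability $q$), or is $0$ (probability $r$). *)

(* Defs.v *)
From HB Require Import structures.
From mathcomp Require Import all_boot all_order all_algebra.
From mathcomp Require Import all_classical all_reals all_analysis.

Set Implicit Arguments.
Unset Strict Implicit.
Unset Printing Implicit Defensive.

Import Order.TTheory GRing.Theory Num.Theory.
Import numFieldNormedType.Exports.
Local Open Scope ring_scope.
Local Open Scope classical_set_scope.

Section defs.
Variable R : realType.

(* Deterministic construction of (X_1, ..., X_n) from the realized values
   x1 = X_1, e i = eta_i (i >= 2), k j = K_j (j >= 3):
     X_2 = e 2 * X_1,   X_{m+1} = e (m+1) * X_{k (m+1)}  for m >= 2.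
   Indices are 1-based; the list (erw_path x1 e k n) is [:: X_1; ...; X_n]. *)
Fixpoint erw_path (x1 : R) (e : nat -> R) (k : nat -> nat) (n : nat) : seq R :=
  match n with
  | 0 => [::]
  | 1 => [:: x1]
  | (m.+1 as n').+1 =>
      let s := erw_path x1 e k n' in
      let idx := if n' == 1%N then 1%N else k n'.+1 in
      rcons s (e n'.+1 * nth 0 s idx.-1)
  end.

Definition erw_sum (x1 : R) (e : nat -> R) (k : nat -> nat) (n : nat) : R :=
  \sum_(x <- erw_path x1 e k n) x.

Definition pmf_step (p q r : R) (v : R) : R :=
  if v == 1 then p else if v == -1 then q else if v == 0 then r else 0.

Definition pmf_K (j m : nat) : R :=
  if (m == 1%N) || (m == j.-1) then 2^-1 else 0.

Definition normal_cdf (s2 x : R) : R :=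
  if s2 == 0 then (if 0 <= x then 1 else 0)
  else fine (normal_prob 0 (Num.sqrt s2) `]-oo, x]).

End defs.

(* Main.v *)
(* A Lindeberg argument for an additive functional of a Markov chain.

   Given X_1 = x0 with x0 = 1 or -1, the pair (S_n, X_n) is a Markov chain, and
   with a = (p - q) / 2 the process M_n = (1 - a) S_n + a X_n - a x0 n is a
   martingale with bounded increments, at bounded distance from
   (1 - a) (S_n - n a x0 / (1 - a)).  The conditional variance of its increments
   is a polynomial in X_n; it differs from its stationary value s0 by
   g - E[g(X_{n+1}) | X_n] for an explicit quadratic g (Poisson equation).
   For a smooth f let F_t be the average of f against the centred normal law of
   variance t, and put e = 1 / ((1 - a) sqrt n), t_k = (n + 1 - k) e^2 s0.  Then
       V_k = F_{t_k}(e M_k) + e^2 / 2 * F_{t_k}''(e M_k) * g(X_k)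
   satisfies E[V_{k+1} | X_1, ..., X_k] = V_k + O(e^3), because F is a
   semigroup in t.  Summing over k < n gives the convergence of
   E[f(e M_n)] with rate 1 / sqrt n, and a cubic spline approximation of the
   indicator of a half-line gives the distribution functions.  Since
   M_n^2 + g(X_n) - s0 n is a martingale, Var(T_n) / n converges to
   s0 / (1 - a)^2.  On X_1 = 0 the walk stays at 0, which produces the atom of
   the mixture. *)
Require Import Defs.
From HB Require Import structures.
From mathcomp Require Import all_boot all_order all_algebra.
From mathcomp Require Import all_classical all_reals all_analysis.
From mathcomp Require Import measurable_realfun.
From mathcomp Require Import ring lra.

Import Order.TTheory GRing.Theory Num.Theory.
Import numFieldNormedType.Exports.
Local Open Scope ring_scope.
Local Open Scope classical_set_scope.

Set Implicit Arguments.
Unset Strict Implicit.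
Unset Printing Implicit Defensive.

(** * Gaussian averages *)

Section has_int.
Context {d : measure_display} {T : measurableType d} {R : realType}.
Variable mu : {measure set T -> \bar R}.
Implicit Types f g : T -> R.

(** Integrability and value travel together, so that the rules of linearity and comparison below
    compose without separate integrability side conditions. *)
Definition has_int f (v : R) :=
  mu.-integrable setT (EFin \o f) /\ (\int[mu]_x (f x)%:E = v%:E)%E.

Lemma has_int_ext f g v : f =1 g -> has_int f v -> has_int g v.
Proof. by move=> /funext ->. Qed.

Lemma has_int_Rintegral f :
  mu.-integrable setT (EFin \o f) -> has_int f (\int[mu]_x f x).
Proof.
by move=> fi; split=> //; rewrite /Rintegral fineK//; exact: integrable_fin_num.
Qed.

Lemma has_intRE f v : has_int f v -> \int[mu]_x f x = v.
Proof. by move=> [_ fv]; rewrite /Rintegral fv. Qed.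

Lemma has_intD f g v w :
  has_int f v -> has_int g w -> has_int (fun x => f x + g x) (v + w).
Proof.
move=> [fi fv] [gi gw]; split; first exact: (integrableD _ fi gi).
under eq_integral do rewrite EFinD.
by rewrite integralD// fv gw.
Qed.

Lemma has_intZ c f v : has_int f v -> has_int (fun x => c * f x) (c * v).
Proof.
move=> [fi fv]; split; first exact: (integrableZl _ _ fi).
under eq_integral do rewrite EFinM.
by rewrite integralZl// fv.
Qed.

Lemma has_intB f g v w :
  has_int f v -> has_int g w -> has_int (fun x => f x - g x) (v - w).
Proof.
move=> fv /(has_intZ (-1)) gw; rewrite -[- w]mulN1r.
by apply: has_int_ext (has_intD fv gw) => x; rewrite mulN1r.
Qed.

Lemma has_int_sum (I : Type) (s : seq I) (f : I -> T -> R) (v : I -> R) :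
  (forall i, has_int (f i) (v i)) ->
  has_int (fun x => \sum_(i <- s) f i x) (\sum_(i <- s) v i).
Proof.
move=> fv; elim: s => [|i s IH].
  rewrite big_nil; apply: (@has_int_ext (cst 0)) => [x|]; first by rewrite big_nil.
  by split; [exact: integrable0|rewrite integral0].
rewrite big_cons; apply: has_int_ext (has_intD (fv i) IH) => x.
by rewrite big_cons.
Qed.

Lemma has_int_le f g v w :
  (forall x, f x <= g x) -> has_int f v -> has_int g w -> v <= w.
Proof.
move=> fg [fi fv] [gi gw]; rewrite -lee_fin -fv -gw.
by apply: le_integral => //= x _; rewrite lee_fin.
Qed.

Lemma has_int_norm_le f g v w :
  (forall x, `|f x| <= g x) -> has_int f v -> has_int g w -> `|v| <= w.
Proof.
move=> fg fv gw; rewrite ler_norml; apply/andP; split.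
  rewrite -mulN1r; apply: has_int_le (has_intZ (-1) gw) fv => x.
  by rewrite mulN1r; have := fg x; rewrite ler_norml => /andP[].
by apply: has_int_le fv gw => x; rewrite (le_trans (ler_norm _)).
Qed.

End has_int.

(** * Moments of the centred normal law *)

Section gauss.
Context {R : realType}.
Implicit Types (s t m : R) (f g h : R -> R).
Notation mu := (@lebesgue_measure R).

Definition gauss_int s h (v : R) :=
  has_int mu (fun z => h z * normal_pdf 0 s z) v.

Definition gauss_able s h :=
  mu.-integrable setT (EFin \o (fun z => h z * normal_pdf 0 s z)).

Definition gmean s h : R := \int[mu]_z (h z * normal_pdf 0 s z).

Lemma gmeanP s h : gauss_able s h -> gauss_int s h (gmean s h).
Proof. exact: has_int_Rintegral. Qed.

Lemma gmeanE s h v : gauss_int s h v -> gmean s h = v.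
Proof. exact: has_intRE. Qed.

Lemma gauss_ext s f g v : f =1 g -> gauss_int s f v -> gauss_int s g v.
Proof. by move=> /funext ->. Qed.

Lemma gaussD s f g v w : gauss_int s f v -> gauss_int s g w ->
  gauss_int s (fun z => f z + g z) (v + w).
Proof.
by move=> fv gw; apply: has_int_ext (has_intD fv gw) => z; rewrite mulrDl.
Qed.

Lemma gaussZ s c f v : gauss_int s f v -> gauss_int s (fun z => c * f z) (c * v).
Proof.
by move=> fv; apply: has_int_ext (has_intZ c fv) => z; rewrite mulrA.
Qed.

Lemma gaussB s f g v w : gauss_int s f v -> gauss_int s g w ->
  gauss_int s (fun z => f z - g z) (v - w).
Proof.
by move=> fv gw; apply: has_int_ext (has_intB fv gw) => z; rewrite mulrBl.
Qed.

Lemma gauss_cst s c : gauss_int s (fun=> c) c.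
Proof.
rewrite -{2}[c]mulr1; apply: has_intZ; split; first exact: integrable_normal_pdf.
exact: integral_normal_pdf.
Qed.

Lemma gauss_norm_le s f g v w :
  (forall z, `|f z| <= g z) -> gauss_int s f v -> gauss_int s g w -> `|v| <= w.
Proof.
move=> fg; apply: has_int_norm_le => z.
by rewrite normrM (ger0_norm (normal_pdf_ge0 _ _ _)) ler_wpM2r// normal_pdf_ge0.
Qed.

Lemma gauss_le s f g v w :
  (forall z, f z <= g z) -> gauss_int s f v -> gauss_int s g w -> v <= w.
Proof.
by move=> fg; apply: has_int_le => z; rewrite ler_wpM2r// normal_pdf_ge0.
Qed.

Lemma gauss_able_le s f g : measurable_fun setT f ->
  (forall z, `|f z| <= g z) -> gauss_able s g -> gauss_able s f.
Proof.
move=> mf fg; apply: le_integrable => //.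
  apply/measurable_EFinP; apply: measurable_funM => //.
  exact: measurable_normal_pdf.
move=> z _ /=; rewrite lee_fin !normrM ler_wpM2r//.
exact: le_trans (fg z) (ler_norm _).
Qed.

Lemma gauss_able_bounded s f B : measurable_fun setT f ->
  (forall z, `|f z| <= B) -> gauss_able s f.
Proof.
by move=> mf fB; apply: gauss_able_le fB _ => //; have [] := gauss_cst s B.
Qed.

Lemma normal_peak_pos s : 0 < s -> normal_peak s = s^-1 * (Num.sqrt (pi *+ 2))^-1.
Proof.
move=> s0; rewrite /normal_peak -mulrnAr sqrtrM ?sqr_ge0//.
by rewrite sqrtr_sqr gtr0_norm// invfM.
Qed.

Lemma normal_pdf_pos m s z : 0 < s ->
  normal_pdf m s z =
  s^-1 * (Num.sqrt (pi *+ 2))^-1 * expR (- (z - m) ^+ 2 / (s ^+ 2 *+ 2)).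
Proof. by move=> s0; rewrite normal_pdfE ?gt_eqF// normal_peak_pos. Qed.

Lemma expR_ge_sqr (x : R) : 0 <= x -> x ^+ 2 / 4 <= expR x.
Proof.
move=> x0; have := expR_ge1Dx (x / 2).
have -> : expR x = expR (x / 2) ^+ 2 by rewrite -expRM_natl; congr expR; field.
by move=> h; nra.
Qed.

Lemma sqrt2pi_gt0 : 0 < (Num.sqrt (pi *+ 2))^-1 :> R.
Proof. by rewrite invr_gt0 sqrtr_gt0 pmulrn_rgt0// pi_gt0. Qed.

(** Part of the Gaussian decay is traded for the polynomial. With [u = z^2 / s^2], the exponentials
    for deviations [s] and [2 * s] differ by the factor [exp (- 3 u / 8)], and [expR_ge_sqr] gives
    [u^2 exp (- 3 u / 8) <= 256 / 9]. As [2 * 256 / 9 < 57], the integrand is below [57 * s^4] times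
    a normal density, which yields integrability and the bound together. *)
Lemma gauss_pow4 s : 0 < s ->
  exists2 v, gauss_int s (fun z => z ^+ 4) v & v <= 57 * s ^+ 4.
Proof.
move=> s0.
have key z : z ^+ 4 * normal_pdf 0 s z <= 57 * s ^+ 4 * normal_pdf 0 (2 * s) z.
  rewrite !normal_pdf_pos ?mulr_gt0// subr0.
  set c := (Num.sqrt _)^-1; have c0 : 0 < c by exact: sqrt2pi_gt0.
  set e := expR (- z ^+ 2 / ((2 * s) ^+ 2 *+ 2)).
  have e0 : 0 < e by exact: expR_gt0.
  set u := z ^+ 2 / s ^+ 2; have u0 : 0 <= u by rewrite divr_ge0 ?sqr_ge0.
  have h : expR (- z ^+ 2 / (s ^+ 2 *+ 2)) * expR (3 / 8 * u) = e.
    by rewrite -expRD; congr expR; rewrite /u; field; rewrite gt_eqF.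
  have := @expR_ge_sqr (3 / 8 * u); rewrite mulr_ge0// => /(_ isT) h2.
  move: h; set e1 := expR (- _ / _) => h.
  have e10 : 0 < e1 by exact: expR_gt0.
  have h3 : e1 * ((3 / 8 * u) ^+ 2 / 4) <= e by rewrite -h ler_pM2l.
  have -> : z ^+ 4 = u ^+ 2 * s ^+ 4 by rewrite /u; field; rewrite gt_eqF.
  have -> : 57 * s ^+ 4 * ((2 * s)^-1 * c * e) = s ^+ 4 * s^-1 * c * (57 / 2 * e).
    by field; rewrite gt_eqF.
  have -> : u ^+ 2 * s ^+ 4 * (s^-1 * c * e1) = s ^+ 4 * s^-1 * c * (u ^+ 2 * e1).
    by field; rewrite gt_eqF.
  rewrite ler_pM2l; last by apply: mulr_gt0 => //; apply: mulr_gt0; rewrite ?invr_gt0 ?exprn_gt0.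
  nra.
have [i2 v2] := gauss_cst (2 * s) (57 * s ^+ 4).
have i4 : gauss_able s (fun z => z ^+ 4).
  apply: le_integrable i2 => //.
    apply/measurable_EFinP; apply: measurable_funM => //.
    exact: measurable_normal_pdf.
  move=> z _ /=; rewrite lee_fin ger0_norm.
    by rewrite (le_trans (key z))// ler_norm.
  by rewrite mulr_ge0 ?normal_pdf_ge0// exprn_even_ge0.
exists (gmean s (fun z => z ^+ 4)); first exact: gmeanP.
exact: (has_int_le (mu := mu) key (gmeanP i4) (gauss_cst (2 * s) (57 * s ^+ 4))).
Qed.

(** Scaling by [s] reduces this to [u <= 1 + u^4]. With the next two lemmas it lets the moments of
    lower order be controlled by the fourth. *)
Lemma abs_le_pow4 s (z : R) : 0 < s -> `|z| <= s + (s ^+ 3)^-1 * z ^+ 4.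
Proof.
move=> s0; set u := `|z| / s.
have u0 : 0 <= u by rewrite divr_ge0// ltW.
have -> : `|z| = u * s by rewrite divfK ?gt_eqF.
have -> : z ^+ 4 = u ^+ 4 * s ^+ 4.
  by rewrite -exprMn divfK ?gt_eqF// -normrX ger0_norm// exprn_even_ge0.
have -> : (s ^+ 3)^-1 * (u ^+ 4 * s ^+ 4) = u ^+ 4 * s by field; rewrite gt_eqF.
rewrite -[X in _ <= X + _]mul1r -mulrDl ler_pM2r//.
have := sqr_ge0 (u ^+ 2 - 1 / 2); have := sqr_ge0 (u - 1 / 2); nra.
Qed.

Lemma abs3_le_pow4 s (z : R) : 0 < s -> `|z| ^+ 3 <= s ^+ 3 + s^-1 * z ^+ 4.
Proof.
move=> s0; set u := `|z| / s.
have u0 : 0 <= u by rewrite divr_ge0// ltW.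
have -> : z ^+ 4 = u ^+ 4 * s ^+ 4.
  by rewrite -exprMn divfK ?gt_eqF// -normrX ger0_norm// exprn_even_ge0.
have -> : `|z| = u * s by rewrite divfK ?gt_eqF.
have -> : s^-1 * (u ^+ 4 * s ^+ 4) = u ^+ 4 * s ^+ 3 by field; rewrite gt_eqF.
rewrite -[X in _ <= X + _]mul1r -mulrDl exprMn ler_pM2r ?exprn_gt0//.
have [u1|u1] := leP u 1; first by have := exprn_ile1 3 u0 u1; have := exprn_ge0 4 u0; lra.
have := exprn_ge0 3 u0; rewrite (exprS u 3); nra.
Qed.

Lemma sqr_le_pow4 s (z : R) : 0 < s -> z ^+ 2 <= s ^+ 2 + (s ^+ 2)^-1 * z ^+ 4.
Proof.
move=> s0; set u := z / s.
have -> : z = u * s by rewrite divfK ?gt_eqF.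
have -> : (s ^+ 2)^-1 * (u * s) ^+ 4 = u ^+ 4 * s ^+ 2 by field; rewrite gt_eqF.
rewrite -[X in _ <= X + _]mul1r -mulrDl exprMn ler_pM2r ?exprn_gt0//.
by have := sqr_ge0 (u ^+ 2 - 1 / 2); nra.
Qed.

Lemma gauss_abs s : 0 < s ->
  exists2 v, gauss_int s (fun z => `|z|) v & v <= 58 * s.
Proof.
move=> s0; have [w w4 wle] := gauss_pow4 s0.
have hw := gaussD (gauss_cst s s) (gaussZ (s ^+ 3)^-1 w4).
have ai : gauss_able s (fun z => `|z|).
  apply: gauss_able_le (proj1 hw) => // z; rewrite normr_id; exact: abs_le_pow4.
exists (gmean s (fun z => `|z|)); first exact: gmeanP.
apply: le_trans (gauss_le (fun z => abs_le_pow4 z s0) (gmeanP ai) hw) _.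
have -> : 58 * s = s + (s ^+ 3)^-1 * (57 * s ^+ 4) by field; rewrite gt_eqF.
by rewrite lerD2l ler_wpM2l// invr_ge0 exprn_ge0// ltW.
Qed.

Lemma gauss_abs3 s : 0 < s ->
  exists2 v, gauss_int s (fun z => `|z| ^+ 3) v & v <= 58 * s ^+ 3.
Proof.
move=> s0; have [w w4 wle] := gauss_pow4 s0.
have hw := gaussD (gauss_cst s (s ^+ 3)) (gaussZ s^-1 w4).
have ai : gauss_able s (fun z => `|z| ^+ 3).
  apply: gauss_able_le (proj1 hw) => [|z].
    by apply: measurable_funX; exact: normr_measurable.
  by rewrite normrX normr_id; exact: abs3_le_pow4.
exists (gmean s (fun z => `|z| ^+ 3)); first exact: gmeanP.
apply: le_trans (gauss_le (fun z => abs3_le_pow4 z s0) (gmeanP ai) hw) _.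
have -> : 58 * s ^+ 3 = s ^+ 3 + s^-1 * (57 * s ^+ 4) by field; rewrite gt_eqF.
by rewrite lerD2l ler_wpM2l// invr_ge0 ltW.
Qed.

(* Tilting: [expR x >= 1 + x] bounds the density with mean [m] from below by
   the centred density times an affine function of [z]. *)
Lemma gauss_id s : 0 < s -> gauss_int s id 0.
Proof.
move=> s0; have [w w1 _] := gauss_abs s0.
have ii : gauss_able s id by exact: gauss_able_le (proj1 w1).
have iP := gmeanP ii; suff e0 : gmean s id = 0 by rewrite e0 in iP.
set v := gmean s id in iP *.
have key m : m * v <= m ^+ 2 / 2.
  have h z : (1 + (m * z / s ^+ 2 - m ^+ 2 / (s ^+ 2 *+ 2))) * normal_pdf 0 s z
      <= normal_pdf m s z.
    rewrite !normal_pdf_pos// subr0.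
    set c := (Num.sqrt _)^-1; have c0 : 0 < c by exact: sqrt2pi_gt0.
    rewrite mulrCA ler_pM2l; last by rewrite mulr_gt0// invr_gt0.
    have -> : - (z - m) ^+ 2 / (s ^+ 2 *+ 2) = (m * z / s ^+ 2 - m ^+ 2 / (s ^+ 2 *+ 2)) +
      (- z ^+ 2 / (s ^+ 2 *+ 2)) by field; rewrite gt_eqF.
    by rewrite expRD ler_pM2r ?expR_gt0// expR_ge1Dx.
  have h1 : gauss_int s (fun z => 1 + (m * z / s ^+ 2 - m ^+ 2 / (s ^+ 2 *+ 2)))
      (1 + (m / s ^+ 2 * v - m ^+ 2 / (s ^+ 2 *+ 2))).
    apply: gaussD; first exact: gauss_cst.
    apply: gaussB; last exact: gauss_cst.
    by apply: gauss_ext (gaussZ (m / s ^+ 2) iP) => z; ring.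
  have h2 : has_int mu (normal_pdf m s) 1.
    by split; [exact: integrable_normal_pdf|exact: integral_normal_pdf].
  have := has_int_le (mu := mu) h h1 h2; rewrite -subr_le0.
  have -> : 1 + (m / s ^+ 2 * v - m ^+ 2 / (s ^+ 2 *+ 2)) - 1 =
    (s ^+ 2)^-1 * (m * v - m ^+ 2 / 2) by field; rewrite gt_eqF.
  by rewrite pmulr_rle0 ?invr_gt0 ?exprn_gt0// subr_le0.
(* The choice [m = v] gives [v^2 <= v^2 / 2]. *)
have := key v; have := sqr_ge0 v => h1 h2.
by apply/eqP; rewrite -sqrf_eq0; apply/eqP/le_anti/andP; split=> //; lra.
Qed.

(* Same device, now comparing with the centred density of another variance. *)
Lemma gauss_sqr s : 0 < s -> gauss_int s (fun z => z ^+ 2) (s ^+ 2).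
Proof.
move=> s0; have [w w4 _] := gauss_pow4 s0.
have hw := gaussD (gauss_cst s (s ^+ 2)) (gaussZ (s ^+ 2)^-1 w4).
have ii : gauss_able s (fun z => z ^+ 2).
  apply: gauss_able_le (proj1 hw) => // z.
  by rewrite ger0_norm ?sqr_ge0//; exact: sqr_le_pow4.
have iP := gmeanP ii; suff e0 : gmean s (fun z => z ^+ 2) = s ^+ 2 by rewrite -e0.
set v := gmean s _ in iP *.
have key t : 0 < t -> v * (t ^+ 2 - s ^+ 2) <= 2 * s * t ^+ 2 * (t - s).
  move=> t0.
  pose k := (s ^+ 2 *+ 2)^-1 - (t ^+ 2 *+ 2)^-1.
  have h z : (1 + k * z ^+ 2) * normal_pdf 0 s z <= t / s * normal_pdf 0 t z.
    rewrite !normal_pdf_pos// subr0.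
    set c := (Num.sqrt _)^-1; have c0 : 0 < c by exact: sqrt2pi_gt0.
    have -> : t / s * (t^-1 * c * expR (- z ^+ 2 / (t ^+ 2 *+ 2))) =
       s^-1 * c * expR (- z ^+ 2 / (t ^+ 2 *+ 2)) by field; rewrite !gt_eqF.
    rewrite mulrCA ler_pM2l; last by rewrite mulr_gt0// invr_gt0.
    have -> : - z ^+ 2 / (t ^+ 2 *+ 2) = k * z ^+ 2 +
      (- z ^+ 2 / (s ^+ 2 *+ 2)) by rewrite /k; field; rewrite !gt_eqF.
    by rewrite expRD ler_pM2r ?expR_gt0// expR_ge1Dx.
  have h1 : gauss_int s (fun z => 1 + k * z ^+ 2) (1 + k * v).
    by apply: gaussD; [exact: gauss_cst|exact: gaussZ].
  have h2 := has_int_le (mu := mu) h h1 (gauss_cst t (t / s)).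
  have : 2 * s ^+ 2 * t ^+ 2 * (1 + k * v) <= 2 * s ^+ 2 * t ^+ 2 * (t / s).
    by rewrite ler_pM2l// !mulr_gt0// exprn_gt0.
  have -> : 2 * s ^+ 2 * t ^+ 2 * (1 + k * v) =
     2 * s ^+ 2 * t ^+ 2 + v * (t ^+ 2 - s ^+ 2) by rewrite /k; field; rewrite !gt_eqF.
  have -> : 2 * s ^+ 2 * t ^+ 2 * (t / s) = 2 * s * t ^+ 2 * t by field; rewrite gt_eqF.
  by move=> ?; lra.
have v0 : 0 <= v.
  by apply: gauss_le (gauss_cst s 0) iP => z; exact: sqr_ge0.
(* Hence [2 s t^2 / (t + s)] bounds [v] from above for [t > s] and from below for [t < s]. Both
   bounds tend to [s^2] as [t] tends to [s]; the limit is taken by hand with [t = s (1 + x)] and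
   [t = s (1 - x)], where [4 s^2 x <= e]. *)
have key2 t : 0 < t -> (t - s) * (v * (t + s) - 2 * s * t ^+ 2) <= 0.
  by move=> t0; have := key t t0; nra.
apply/eqP; rewrite eq_le; apply/andP; split.
- apply/ler_addgt0Pl => e e0; rewrite leNgt; apply/negP => ev.
  pose x := Num.min 1 (e / (4 * s ^+ 2)).
  have s20 : 0 < s ^+ 2 by rewrite exprn_gt0.
  have x0 : 0 < x by rewrite /x lt_min ltr01 divr_gt0// mulr_gt0.
  have x1 : x <= 1 by rewrite ge_min lexx.
  have x2 : x * (4 * s ^+ 2) <= e.
    by rewrite -ler_pdivlMr ?mulr_gt0// ge_min lexx orbT.
  have st : 0 < s * (1 + x) by rewrite mulr_gt0// ltr_wpDl.
  have := key2 _ st.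
  rewrite leNgt => /negP; apply; apply: mulr_gt0; first by nra.
  have : s ^+ 2 * (1 + 4 * x) * (s * (2 + x)) < v * (s * (2 + x)).
    rewrite ltr_pM2r; last by rewrite mulr_gt0// ltr_wpDl.
    by apply: le_lt_trans ev; nra.
  suff : 2 * s * (s * (1 + x)) ^+ 2 <= s ^+ 2 * (1 + 4 * x) * (s * (2 + x)).
    move=> h1 h2; have -> : v * (s * (1 + x) + s) = v * (s * (2 + x)) by ring.
    by lra.
  have -> : 2 * s * (s * (1 + x)) ^+ 2 = s ^+ 3 * (2 * (1 + x) ^+ 2) by ring.
  have -> : s ^+ 2 * (1 + 4 * x) * (s * (2 + x)) = s ^+ 3 * ((1 + 4 * x) * (2 + x)) by ring.
  by rewrite ler_pM2l ?exprn_gt0//; nra.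
- apply/ler_addgt0Pl => e e0; rewrite leNgt; apply/negP => ev.
  pose x := Num.min (1 / 2) (e / (4 * s ^+ 2)).
  have s20 : 0 < s ^+ 2 by rewrite exprn_gt0.
  have x0 : 0 < x by rewrite /x lt_min divr_gt0// divr_gt0// mulr_gt0.
  have x1 : x <= 1 / 2 by rewrite ge_min lexx.
  have x2 : x * (4 * s ^+ 2) <= e.
    by rewrite -ler_pdivlMr ?mulr_gt0// ge_min lexx orbT.
  have st : 0 < s * (1 - x) by rewrite mulr_gt0//; lra.
  have := key2 _ st.
  rewrite leNgt => /negP; apply; rewrite nmulr_lgt0; first by nra.
  have : v * (s * (2 - x)) < s ^+ 2 * (1 - 4 * x) * (s * (2 - x)).
    rewrite ltr_pM2r; last by rewrite mulr_gt0//; lra.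
    by nra.
  suff : s ^+ 2 * (1 - 4 * x) * (s * (2 - x)) <= 2 * s * (s * (1 - x)) ^+ 2.
    move=> h1 h2; have -> : v * (s * (1 - x) + s) = v * (s * (2 - x)) by ring.
    by lra.
  have -> : 2 * s * (s * (1 - x)) ^+ 2 = s ^+ 3 * (2 * (1 - x) ^+ 2) by ring.
  have -> : s ^+ 2 * (1 - 4 * x) * (s * (2 - x)) = s ^+ 3 * ((1 - 4 * x) * (2 - x)) by ring.
  by rewrite ler_pM2l ?exprn_gt0//; nra.
Qed.

End gauss.

(** * Convolution with the centred normal law *)

Section gconv.
Context {R : realType}.
Implicit Types (s t u m B : R) (f g : R -> R).
Notation mu := (@lebesgue_measure R).

Definition lipB B f := forall x h : R, `|f (x + h) - f x| <= B * `|h|.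

(** For [s > 0] this is the average [F_t] at time [t = s^2]: the index is a standard deviation, so
    the semigroup law takes the form [u^2 = s^2 + t^2]. *)
Definition gconv s f x := gmean s (fun z => f (x + z)).

Lemma lipB_continuous B f : lipB B f -> continuous f.
Proof.
move=> fB x; apply/cvgrPdist_le => e e0.
have B0 : 0 <= B by have := fB 0 1; rewrite normr1 mulr1; apply: le_trans.
near=> y; rewrite distrC -[y](subrKC x).
apply: le_trans (fB _ _) _.
apply: (@le_trans _ _ ((B + 1) * `|y - x|)); first by rewrite ler_wpM2r// lerDl.
rewrite mulrC -ler_pdivlMr ?ltr_wpDl// distrC.
by near: y; apply: cvgr_dist_le; [exact: cvg_id|rewrite divr_gt0// ltr_wpDl].
Unshelve. all: by end_near. Qed.

Lemma lipB_measurable B f : lipB B f -> measurable_fun setT f.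
Proof. by move=> /lipB_continuous fc; exact: continuous_measurable_fun. Qed.

Lemma lipB_shift B f x : lipB B f -> lipB B (fun z => f (x + z)).
Proof. by move=> fB y h; rewrite addrA; exact: fB. Qed.

Lemma gconv_int s B B' f x : lipB B f -> (forall z, `|f z| <= B') ->
  gauss_int s (fun z => f (x + z)) (gconv s f x).
Proof.
move=> fL fB; apply/gmeanP/(@gauss_able_bounded _ _ _ B') => //.
exact: (lipB_measurable (lipB_shift x fL)).
Qed.

Lemma gconv_bounded s B B' f x : lipB B f -> (forall z, `|f z| <= B') ->
  `|gconv s f x| <= B'.
Proof.
move=> fL fB; apply: gauss_norm_le (gconv_int s x fL fB) (gauss_cst s B') => z.
exact: fB.
Qed.

Lemma gconv_lip s B B' f : lipB B f -> (forall z, `|f z| <= B') -> lipB B (gconv s f).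
Proof.
move=> fL fB x h.
apply: gauss_norm_le
  (gaussB (gconv_int s (x + h) fL fB) (gconv_int s x fL fB))
  (gauss_cst s (B * `|h|)) => z.
by rewrite addrAC; exact: fL.
Qed.

Lemma gconv_close s B B' f x : 0 < s -> lipB B f -> (forall z, `|f z| <= B') ->
  `|gconv s f x - f x| <= 58 * B * s.
Proof.
move=> s0 fL fB; have [v vi vs] := gauss_abs s0.
have B0 : 0 <= B by have := fL 0 1; rewrite normr1 mulr1; apply: le_trans.
apply: (@le_trans _ _ (B * v)).
  apply: gauss_norm_le (gaussB (gconv_int s x fL fB) (gauss_cst s (f x)))
    (gaussZ B vi) => z.
  exact: fL.
by rewrite -mulrA mulrCA ler_wpM2l.
Qed.

(** Translation invariance, obtained as a change of variables with derivative 1. *)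
Lemma integral_shift (G : R -> R) y : continuous G -> (forall x, 0 <= G x) ->
  (\int[mu]_x (G x)%:E = \int[mu]_x (G (x + y))%:E)%E.
Proof.
move=> Gc G0; pose F (x : R^o) : R^o := x + y.
have F'E : F^`()%classic = cst 1.
  apply/funext => x; rewrite /F derive1E deriveD// derive_cst derive_id.
  by rewrite addr0.
rewrite (@increasing_ge0_integration_by_substitutionT _ F)//.
- by apply: eq_integral => x _; rewrite F'E !fctE/= mulr1.
- by move=> u v uv; rewrite /F ltrD2r.
- by rewrite F'E => ?; exact: cvg_cst.
- by rewrite F'E; exact: is_cvg_cst.
- by rewrite F'E; exact: is_cvg_cst.
- exact: cvg_addrr_Ny.
- exact: cvg_addrr.
Qed.

(* Completing the square. *)
Lemma normal_pdf_mul s t u w y : 0 < s -> 0 < t -> 0 < u ->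
  u ^+ 2 = s ^+ 2 + t ^+ 2 ->
  normal_pdf 0 t (w - y) * normal_pdf 0 s y =
  normal_pdf 0 u w * normal_pdf (w * s ^+ 2 / u ^+ 2) (s * t / u) y.
Proof.
move=> s0 t0 u0 ust.
have c0 : 0 < s * t / u by rewrite divr_gt0 ?mulr_gt0.
rewrite !normal_pdf_pos// !subr0.
set k := (Num.sqrt _)^-1.
have reg (A1 A2 : R) :
  t^-1 * k * expR A1 * (s^-1 * k * expR A2) =
  (t^-1 * s^-1) * k ^+ 2 * expR (A1 + A2) by rewrite expRD; ring.
rewrite reg.
have -> : (s * t / u)^-1 = u / (s * t) by rewrite invf_div.
have -> : forall A1 A2 : R, u^-1 * k * expR A1 * (u / (s * t) * k * expR A2) =
  (t^-1 * s^-1) * k ^+ 2 * expR (A1 + A2).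
  by move=> A1 A2; rewrite expRD; field; rewrite !gt_eqF.
congr (_ * expR _).
have u20 : s ^+ 2 + t ^+ 2 != 0 by rewrite -ust gt_eqF// exprn_gt0.
rewrite !exprMn !exprVn ust.
by field; rewrite u20 !gt_eqF.
Qed.

(** After a translation of the inner variable, Tonelli exchanges the two integrals; by
    [normal_pdf_mul] the integral over [y] is then that of a probability density. Nonnegativity of
    [f] is what Tonelli asks for. *)
Lemma gconv_conv_ge0 s t u B B' f x : 0 < s -> 0 < t -> 0 < u ->
  u ^+ 2 = s ^+ 2 + t ^+ 2 -> lipB B f ->
  (forall z, `|f z| <= B') -> (forall z, 0 <= f z) ->
  gconv s (gconv t f) x = gconv u f x.
Proof.
move=> s0 t0 u0 ust fL fB f0.
have mpdf m r : measurable_fun setT (normal_pdf m r) := measurable_normal_pdf m r.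
have fm : measurable_fun setT f := lipB_measurable fL.
rewrite /gconv /gmean /Rintegral; congr fine.
have -> : (\int[mu]_y (gmean t (fun z => f (x + y + z)) * normal_pdf 0 s y)%:E =
   \int[mu]_y \int[mu]_w (f (x + w) * normal_pdf 0 t (w - y) * normal_pdf 0 s y)%:E)%E.
  apply: eq_integral => y _.
  have [_ ty] := gconv_int t (x + y) fL fB.
  rewrite EFinM -[X in (X%:E * _)%E]/(gconv t f (x + y)) -ty.
  under [RHS]eq_integral do rewrite EFinM.
  rewrite ge0_integralZr//; last 3 first.
  - apply/measurable_EFinP; apply: measurable_funM.
      by apply: measurableT_comp => //; exact: measurable_funD.
    by apply: measurableT_comp => //; exact: measurable_funB.
  - by move=> w _; rewrite lee_fin mulr_ge0// normal_pdf_ge0.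
  - by rewrite lee_fin normal_pdf_ge0.
  congr mule.
  rewrite [RHS](@integral_shift _ y).
  - by apply: eq_integral => w _; rewrite addrK addrAC addrA.
  - move=> w; apply: cvgM.
      apply: (cvg_comp (fun w => x + w) f); last exact: lipB_continuous fL _.
      by apply: (@cvgD _ R^o) => //; exact: cvg_cst.
    apply: (cvg_comp (fun w => w - y) (normal_pdf 0 t)).
      by apply: (@cvgB _ R^o) => //; [exact: cvg_id|exact: cvg_cst].
    by apply: continuous_normal_pdf; rewrite gt_eqF.
  - by move=> w; rewrite mulr_ge0// normal_pdf_ge0.
have -> : (\int[mu]_y \int[mu]_w
     (f (x + w) * normal_pdf 0 t (w - y) * normal_pdf 0 s y)%:E =
   \int[mu]_w \int[mu]_y
     (f (x + w) * normal_pdf 0 t (w - y) * normal_pdf 0 s y)%:E)%E.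
  apply: (@fubini_tonelli _ _ _ _ _ mu mu
    (fun p : R * R =>
       (f (x + p.2) * normal_pdf 0 t (p.2 - p.1) * normal_pdf 0 s p.1)%:E)).
    apply/measurable_EFinP; apply: measurable_funM; last exact: measurableT_comp.
    apply: measurable_funM; apply: measurableT_comp => //.
      exact: measurable_funD.
    exact: measurable_funB.
  by move=> p; rewrite lee_fin !mulr_ge0// normal_pdf_ge0.
apply: eq_integral => w _.
under eq_integral do rewrite -mulrA (normal_pdf_mul _ _ s0 t0 u0 ust) mulrA EFinM.
rewrite ge0_integralZl//; last 3 first.
- by apply/measurable_EFinP; exact: measurable_normal_pdf.
- by move=> y _; rewrite lee_fin normal_pdf_ge0.
- by rewrite lee_fin mulr_ge0// normal_pdf_ge0.
by rewrite integral_normal_pdf mule1.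
Qed.

(** Adding the bound [B'] to [f] makes it nonnegative, and Gaussian averages commute with adding a
    constant. *)
Lemma gconv_conv s t u B B' f x : 0 < s -> 0 < t -> 0 < u ->
  u ^+ 2 = s ^+ 2 + t ^+ 2 -> lipB B f -> (forall z, `|f z| <= B') ->
  gconv s (gconv t f) x = gconv u f x.
Proof.
move=> s0 t0 u0 ust fL fB.
pose g z := f z + B'.
have gL : lipB B g.
  by move=> y h; rewrite /g opprD addrACA subrr addr0; exact: fL.
have g0 z : 0 <= g z by have := fB z; rewrite ler_norml /g => /andP[]; lra.
have gB z : `|g z| <= B' + B'.
  by rewrite ger0_norm// /g lerD2r; exact: le_trans (ler_norm _) (fB z).
have cg r y : gconv r g y = gconv r f y + B'.
  by apply: gmeanE; apply: gaussD (gconv_int _ _ fL fB) (gauss_cst _ _).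
have := @gconv_conv_ge0 s t u B _ g x s0 t0 u0 ust gL gB g0.
rewrite cg.
have -> : gconv t g = (fun y => gconv t f y + B') by apply/funext => y.
rewrite (_ : gconv s _ x = gconv s (gconv t f) x + B'); first by move/addIr.
apply: gmeanE; apply: gaussD (gauss_cst _ _).
apply: (@gconv_int _ B B') => [|z]; first exact: gconv_lip fL fB.
exact: gconv_bounded fL fB.
Qed.

(* [f1] and [f2] stand for the first two derivatives of [f]. Stated through the
   Taylor estimate, the notion passes to Gaussian averages without
   differentiating under the integral sign. *)
Definition jet B f f1 f2 :=
  [/\ [/\ lipB B f, lipB B f1 & lipB B f2],
      [/\ forall x, `|f x| <= B, forall x, `|f1 x| <= B & forall x, `|f2 x| <= B]
    & forall x h, `|f (x + h) - (f x + h * f1 x + h ^+ 2 / 2 * f2 x)| <= B * `|h| ^+ 3].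

Lemma jet_gconv s B f f1 f2 : jet B f f1 f2 ->
  jet B (gconv s f) (gconv s f1) (gconv s f2).
Proof.
move=> [[L0 L1 L2] [B0 B1 B2] T].
split; first by split; exact: gconv_lip.
  by split=> x; exact: gconv_bounded.
move=> x h.
have i := gaussB (gconv_int s (x + h) L0 B0)
  (gaussD (gaussD (gconv_int s x L0 B0) (gaussZ h (gconv_int s x L1 B1)))
    (gaussZ (h ^+ 2 / 2) (gconv_int s x L2 B2))).
apply: gauss_norm_le i (gauss_cst s (B * `|h| ^+ 3)) => z.
by rewrite addrAC; exact: T.
Qed.

(** Average the Taylor estimate: the linear term vanishes, the quadratic one produces [s^2 / 2], and
    the remainder is paid by the third absolute moment. *)
Lemma jet_gconv_taylor s B f f1 f2 x : 0 < s -> jet B f f1 f2 ->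
  `|gconv s f x - (f x + s ^+ 2 / 2 * f2 x)| <= 58 * B * s ^+ 3.
Proof.
move=> s0 [[L0 L1 L2] [B0 B1 B2] T].
have [v vi vs] := gauss_abs3 s0.
have Bp : 0 <= B by exact: le_trans (B0 0).
apply: (@le_trans _ _ (B * v)); last by rewrite -mulrA mulrCA ler_wpM2l.
have i := gaussB (gconv_int s x L0 B0)
  (gaussD (gaussD (gauss_cst s (f x)) (gaussZ (f1 x) (gauss_id s0)))
    (gaussZ (f2 x / 2) (gauss_sqr s0))).
rewrite (_ : _ + _ * f2 x = f x + f1 x * 0 + f2 x / 2 * s ^+ 2); last by ring.
apply: gauss_norm_le i (gaussZ B vi) => z /=.
rewrite (_ : _ + f2 x / 2 * _ = f x + z * f1 x + z ^+ 2 / 2 * f2 x); last by ring.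
exact: T.
Qed.

End gconv.

(** * A spline test function *)

Section spline.
Context {R : realType}.
Implicit Types (t h c k B : R).

Definition ppos t := Num.max t 0.

Lemma ppos_le0 t : t <= 0 -> ppos t = 0.
Proof. by move=> t0; rewrite /ppos max_r. Qed.

Lemma ppos_ge0 t : 0 <= t -> ppos t = t.
Proof. by move=> t0; rewrite /ppos max_l. Qed.

Lemma ppos_lip t h : `|ppos (t + h) - ppos t| <= `|h|.
Proof.
have [t0|/ltW t0] := leP t 0; have [u0|/ltW u0] := leP (t + h) 0;
rewrite ?(ppos_le0 t0) ?(ppos_le0 u0) ?(ppos_ge0 t0) ?(ppos_ge0 u0);
have [h0|/ltW h0] := leP 0 h; rewrite ?(ger0_norm h0) ?(ler0_norm h0) ler_norml; lra.
Qed.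

(** Truncated powers are the building blocks of splines; the four cases are the signs of [t] and
    [t + h]. *)
Lemma ppos_taylor2 t h : `|ppos (t + h) ^+ 2 - (ppos t ^+ 2 + 2 * h * ppos t)| <= h ^+ 2.
Proof.
have [t0|/ltW t0] := leP t 0; have [u0|/ltW u0] := leP (t + h) 0;
rewrite ?(ppos_le0 t0) ?(ppos_le0 u0) ?(ppos_ge0 t0) ?(ppos_ge0 u0) ler_norml;
apply/andP; split; nra.
Qed.

Lemma ppos_taylor3 t h :
  `|ppos (t + h) ^+ 3 - (ppos t ^+ 3 + 3 * h * ppos t ^+ 2 + 3 * h ^+ 2 * ppos t)| <= `|h| ^+ 3.
Proof.
have [t0|/ltW t0] := leP t 0; have [u0|/ltW u0] := leP (t + h) 0;
rewrite ?(ppos_le0 t0) ?(ppos_le0 u0) ?(ppos_ge0 t0) ?(ppos_ge0 u0).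
- rewrite (_ : _ - _ = 0); first by rewrite normr0 exprn_ge0.
  by ring.
- rewrite (_ : _ - _ = (t + h) ^+ 3); last by ring.
  rewrite normrX lerXn2r ?nnegrE// (ger0_norm u0).
  by apply: le_trans (ler_norm _); lra.
- rewrite (_ : _ - _ = h ^+ 3 - (t + h) ^+ 3); last by ring.
  have h0 : h <= 0 by lra.
  have c3 (x : R) : x ^+ 3 = - (- x) ^+ 3 by ring.
  have v1 : (- (t + h)) ^+ 3 <= (- h) ^+ 3 by rewrite lerXn2r ?nnegrE; lra.
  have v2 : 0 <= (- (t + h)) ^+ 3 by rewrite exprn_ge0//; lra.
  rewrite (ler0_norm h0) (c3 h) (c3 (t + h)) ler_norml; lra.
- by rewrite (_ : _ - _ = h ^+ 3) ?normrX//; ring.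
Qed.

(** The distribution function of a sum of three independent uniform variables on [[0, 1]]: a cubic
    spline rising from 0 to 1 on [[0, 3]]. The next two definitions are its first two
    derivatives. *)
Definition spline t :=
  (ppos t ^+ 3 - 3 * ppos (t - 1) ^+ 3 + 3 * ppos (t - 2) ^+ 3 - ppos (t - 3) ^+ 3) / 6.
Definition spline1 t :=
  (ppos t ^+ 2 - 3 * ppos (t - 1) ^+ 2 + 3 * ppos (t - 2) ^+ 2 - ppos (t - 3) ^+ 2) / 2.
Definition spline2 t := ppos t - 3 * ppos (t - 1) + 3 * ppos (t - 2) - ppos (t - 3).

Lemma spline_range t :
  [/\ 0 <= spline t <= 1, -10 <= spline1 t <= 10 & -10 <= spline2 t <= 10].
Proof.
rewrite /spline /spline1 /spline2.
have [t0|/ltW t0] := leP t 0.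
  by rewrite !ppos_le0; try lra; split; nra.
have [t1|/ltW t1] := leP t 1.
  by rewrite (ppos_ge0 t0) !ppos_le0; try lra; split; nra.
have [t2|/ltW t2] := leP t 2.
  rewrite (ppos_ge0 t0) (@ppos_ge0 (t - 1)) ?(@ppos_le0 (t - 2)) ?(@ppos_le0 (t - 3)); try lra.
  set u := t - 1; have -> : t = 1 + u by rewrite /u; ring.
  have u0 : 0 <= u by rewrite /u; lra.
  have u1 : u <= 1 by rewrite /u; lra.
  have e : ((1 + u) ^+ 3 - 3 * u ^+ 3 + 3 * 0 ^+ 3 - 0 ^+ 3) / 6 =
    (1 + 3 * u + 3 * u ^+ 2 - 2 * u ^+ 3) / 6 :> R by ring.
  rewrite e; have v0 : 0 <= u ^+ 2 * (1 - u) by rewrite mulr_ge0 ?sqr_ge0//; lra.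
  have v1 : 0 <= u * (1 - u) by rewrite mulr_ge0//; lra.
  have v2 : 0 <= (1 - u) ^+ 2 * u by rewrite mulr_ge0 ?sqr_ge0.
  have v3 : 0 <= u ^+ 3 by exact: exprn_ge0.
  split; nra.
have [t3|/ltW t3] := leP t 3.
  rewrite (ppos_ge0 t0) (@ppos_ge0 (t - 1)) ?(@ppos_ge0 (t - 2)) ?(@ppos_le0 (t - 3)); try lra.
  set u := 3 - t; have -> : t = 3 - u by rewrite /u; ring.
  have u0 : 0 <= u by rewrite /u; lra.
  have u1 : u <= 1 by rewrite /u; lra.
  have e : ((3 - u) ^+ 3 - 3 * (3 - u - 1) ^+ 3 + 3 * (3 - u - 2) ^+ 3 - 0 ^+ 3) / 6 =
    1 - u ^+ 3 / 6 :> R by field.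
  rewrite e; have := exprn_ge0 3 u0; have := exprn_ile1 3 u0 u1.
  by move=> v3 v4; split; nra.
by rewrite !ppos_ge0; try lra; split; nra.
Qed.

Lemma spline_eq0 t : t <= 0 -> spline t = 0.
Proof. by move=> t0; rewrite /spline !ppos_le0; try lra; ring. Qed.

Lemma spline_eq1 t : 3 <= t -> spline t = 1.
Proof. by move=> t3; rewrite /spline !ppos_ge0; try lra; field. Qed.

(** Increments with [|h| > 1] are handled by boundedness alone, so Taylor estimates need only be
    exploited for small [h]. *)
Lemma lipB_local B (f : R -> R) : 0 <= B -> (forall x, `|f x| <= B) ->
  (forall x h : R, `|h| <= 1 -> `|f (x + h) - f x| <= 2 * B * `|h|) -> lipB (2 * B) f.
Proof.
move=> B0 fB fl x h; have [/fl//|/ltW h1] := leP `|h| 1.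
apply: le_trans (ler_normB _ _) _.
apply: (@le_trans _ _ (2 * B)); last by rewrite ler_peMr// mulr_ge0.
by have := fB (x + h); have := fB x; lra.
Qed.

(** The coefficients 1, 3, 3, 1 add up to 8; division by 1, 2 and 6 gives the constants of [L2],
    [T1] and [T]. For [|h| <= 1] the last two also give the Lipschitz bounds of [spline1] and
    [spline]. The value 100 is a crude common bound. *)
Lemma spline_jet : jet 100 spline spline1 spline2.
Proof.
have R0 t : `|spline t| <= 10 by have [] := spline_range t; rewrite ler_norml; lra.
have R1 t : `|spline1 t| <= 10 by have [] := spline_range t; rewrite ler_norml; lra.
have R2 t : `|spline2 t| <= 10 by have [] := spline_range t; rewrite ler_norml; lra.
have S t h : t + h - 1 = t - 1 + h /\ t + h - 2 = t - 2 + h /\ t + h - 3 = t - 3 + h.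
  by split; [ring|split; ring].
have L2 t h : `|spline2 (t + h) - spline2 t| <= 8 * `|h|.
  have [e1 [e2 e3]] := S t h.
  have := ppos_lip t h; have := ppos_lip (t - 1) h; have := ppos_lip (t - 2) h.
  have := ppos_lip (t - 3) h; rewrite /spline2 e1 e2 e3 !ler_norml; lra.
have T1 t h : `|spline1 (t + h) - (spline1 t + h * spline2 t)| <= 4 * h ^+ 2.
  have [e1 [e2 e3]] := S t h.
  have := ppos_taylor2 t h; have := ppos_taylor2 (t - 1) h; have := ppos_taylor2 (t - 2) h.
  have := ppos_taylor2 (t - 3) h; rewrite /spline1 /spline2 e1 e2 e3 !ler_norml.
  nra.
have T t h : `|spline (t + h) - (spline t + h * spline1 t + h ^+ 2 / 2 * spline2 t)|
     <= 2 * `|h| ^+ 3.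
  have [e1 [e2 e3]] := S t h.
  have h3 : 0 <= `|h| ^+ 3 by rewrite exprn_ge0.
  have := ppos_taylor3 t h; have := ppos_taylor3 (t - 1) h; have := ppos_taylor3 (t - 2) h.
  have := ppos_taylor3 (t - 3) h; rewrite /spline /spline1 /spline2 e1 e2 e3 !ler_norml.
  lra.
have wk f B : lipB B f -> B <= 100 -> lipB 100 f.
  by move=> fL B1 x h; apply: le_trans (fL x h) _; rewrite ler_wpM2r.
have sqh (h : R) : `|h| <= 1 -> `|h| ^+ 2 <= `|h|.
  by move=> h1; have := normr_ge0 h; nra.
have cbh (h : R) : `|h| <= 1 -> `|h| ^+ 3 <= `|h|.
  by move=> h1; have := sqh h h1; have := normr_ge0 h; rewrite exprS; nra.
have prod (h z : R) : `|z| <= 10 -> `|h * z| <= 10 * `|h|.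
  by move=> z1; rewrite normrM mulrC ler_wpM2r.
split.
- split; last by (apply: wk L2 _; lra).
    apply: (@wk _ (2 * 50)); last lra; apply: lipB_local => // [x|x h h1].
      by have := R0 x; lra.
    have := prod h _ (R1 x); have := cbh h h1; have := sqh h h1.
    have := prod (h ^+ 2) _ (R2 x); rewrite normrX.
    have := T x h; rewrite !ler_norml; lra.
  apply: (@wk _ (2 * 50)); last lra; apply: lipB_local => // [x|x h h1].
    by have := R1 x; lra.
  have := prod h _ (R2 x); have := sqh h h1.
  have := T1 x h; rewrite -(real_normK (num_real h)) !ler_norml; lra.
- by split=> x; [have := R0 x|have := R1 x|have := R2 x]; lra.
- move=> x h; apply: le_trans (T x h) _; rewrite ler_wpM2r ?exprn_ge0//; lra.
Qed.

(** The reflection turns a rising profile into a smoothed indicator of a left half-line ending at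
    [c], with transition width of order [1 / k]. As [k >= 1], the factor [k^3] dominates the factors
    of all orders. *)
Lemma jet_scale B c k f f1 f2 : 1 <= k -> jet B f f1 f2 ->
  jet (B * k ^+ 3) (fun y => f (k * (c - y))) (fun y => - k * f1 (k * (c - y)))
    (fun y => k ^+ 2 * f2 (k * (c - y))).
Proof.
move=> k1 [[L0 L1 L2] [B0 B1 B2] T].
have k0 : 0 <= k by lra.
have nk : `|k| = k by rewrite ger0_norm.
have Bp : 0 <= B by exact: le_trans (B0 0).
have k13 : k <= k ^+ 3 by rewrite -{1}[k]expr1 ler_weXn2l.
have k23 : k ^+ 2 <= k ^+ 3 by rewrite ler_weXn2l.
have k03 : 1 <= k ^+ 3 by rewrite exprn_ege1.
have sh y h : k * (c - (y + h)) = k * (c - y) + - (k * h) by ring.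
have nh (h : R) : `|- (k * h)| = k * `|h| by rewrite normrN normrM nk.
split; [split=> y h|split=> y|move=> y h].
- rewrite sh; apply: le_trans (L0 _ _) _; rewrite nh mulrA ler_wpM2r//.
  by rewrite ler_wpM2l.
- rewrite sh -mulrBr normrM normrN nk.
  apply: le_trans (ler_wpM2l k0 (L1 _ _)) _; rewrite nh.
  rewrite [leLHS](_ : _ = B * k ^+ 2 * `|h|); last by ring.
  by rewrite ler_wpM2r// ler_wpM2l.
- rewrite sh -mulrBr normrM normrX nk.
  apply: le_trans (ler_wpM2l (exprn_ge0 2 k0) (L2 _ _)) _; rewrite nh.
  by rewrite [leLHS](_ : _ = B * k ^+ 3 * `|h|); last by ring.
- by apply: le_trans (B0 _) _; rewrite ler_peMr.
- rewrite normrM normrN nk mulrC; apply: le_trans (ler_wpM2r k0 (B1 _)) _.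
  by rewrite ler_wpM2l.
- rewrite normrM normrX nk mulrC.
  by apply: le_trans (ler_wpM2r (exprn_ge0 2 k0) (B2 _)) _; rewrite ler_wpM2l.
- rewrite sh; have := T (k * (c - y)) (- (k * h)); rewrite nh exprMn mulrA.
  by congr (`|_ - _| <= _); ring.
Qed.

End spline.

(** * The Markov chain and its central limit theorem *)

Section walk_defs.
Context {R : realType}.
Variables (p q r x0 : R).

(* Transition operator of the Markov chain [(S_n, X_n)] for the walk started
   from the first step [x0]. *)
Definition walk_step (G : R -> R -> R) (s y : R) : R :=
  p / 2 * G (s + x0) x0 + p / 2 * G (s + y) y
  + q / 2 * G (s - x0) (- x0) + q / 2 * G (s - y) (- y) + r * G s 0.

(** The expectation of [G (S_n, X_n)]: the chain starts at time 1 in [(x0, x0)], hence [n - 1]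
    transitions. The first of them reproduces [X_2 = eta_2 X_1], because both remembered steps then
    equal [x0]. *)
Definition walk_mean (n : nat) (G : R -> R -> R) : R := iter n.-1 walk_step G x0 x0.

End walk_defs.

Section walk.
Context {R : realType}.
Variables (p q r x0 : R).
Hypotheses (p0 : 0 < p) (q0 : 0 < q) (r0 : 0 < r) (pqr : p + q + r = 1).
Hypothesis x01 : x0 = 1 \/ x0 = -1.
Implicit Types (G H : R -> R -> R) (s y : R).

Local Notation step := (walk_step p q r x0).
Local Notation U := (walk_mean p q r x0).

Local Ltac plra := move: (p0) (q0) (r0) (pqr) => ? ? ? ?; lra.

Let x0n : `|x0| <= 1.
Proof. by case: x01 => ->; rewrite ?normrN normr1. Qed.

Lemma step_lin al be G H s y :
  step (fun s y => al * G s y + be * H s y) s y = al * step G s y + be * step H s y.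
Proof. by rewrite /walk_step; ring. Qed.

Lemma step_le G H s y : `|y| <= 1 ->
  (forall z, `|z| <= 1 -> G (s + z) z <= H (s + z) z) -> step G s y <= step H s y.
Proof.
move=> y1 GH; rewrite /walk_step.
have h1 := GH _ x0n; have h2 := GH _ y1.
have h3 := GH (- x0); rewrite normrN in h3; have {}h3 := h3 x0n.
have h4 := GH (- y); rewrite normrN in h4; have {}h4 := h4 y1.
have h5 := GH 0; rewrite normr0 addr0 in h5; have {}h5 := h5 ler01.
have p2 : 0 <= p / 2 by plra.
have q2 : 0 <= q / 2 by plra.
apply: lerD (ler_wpM2l (ltW r0) h5); apply: lerD (ler_wpM2l q2 h4).
apply: lerD (ler_wpM2l q2 h3); exact: lerD (ler_wpM2l p2 h1) (ler_wpM2l p2 h2).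
Qed.

Lemma step_cst c s y : step (fun _ _ => c) s y = c.
Proof. have rE : r = 1 - p - q by move: (pqr) => ?; lra.
by rewrite /walk_step rE; field. Qed.

Lemma step_close G H K s y : `|y| <= 1 ->
  (forall z, `|z| <= 1 -> `|G (s + z) z - H (s + z) z| <= K) ->
  `|step G s y - step H s y| <= K.
Proof.
move=> y1 GH; have -> : step G s y - step H s y =
    step (fun s y => 1 * G s y + (-1) * H s y) s y by rewrite step_lin; ring.
rewrite ler_norml; apply/andP; split.
  rewrite -(step_cst (- K) s y); apply: step_le => // z z1.
  by have := GH z z1; rewrite ler_norml; lra.
rewrite -[leRHS](step_cst K s y); apply: step_le => // z z1.
by have := GH z z1; rewrite ler_norml; lra.
Qed.

Lemma walk_meanS n G : (0 < n)%N -> U n.+1 G = U n (step G).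
Proof. by case: n => // n _; rewrite /walk_mean iterSr. Qed.

Lemma walk_mean_lin n al be G H :
  U n (fun s y => al * G s y + be * H s y) = al * U n G + be * U n H.
Proof.
rewrite /walk_mean; move: n.-1 => k.
suff h : iter k step (fun s y => al * G s y + be * H s y) =
    (fun s y => al * iter k step G s y + be * iter k step H s y) by rewrite h.
elim: k => //= k ->; apply/funext => s; apply/funext => y.
exact: step_lin.
Qed.

Lemma walk_mean_le n G H :
  (forall s y, `|y| <= 1 -> G s y <= H s y) -> U n G <= U n H.
Proof.
move=> GH; rewrite /walk_mean.
suff h k s y : `|y| <= 1 -> iter k step G s y <= iter k step H s y by exact: h.
elim: k s y => [|k IH] s y y1 /=; first exact: GH.
by apply: step_le => // z z1; exact: IH.
Qed.

Lemma walk_mean_cst n c : U n (fun _ _ => c) = c.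
Proof.
rewrite /walk_mean.
suff h k : iter k step (fun _ _ => c) = (fun _ _ => c) by rewrite h.
elim: k => //= k ->; apply/funext => s; apply/funext => y.
exact: step_cst.
Qed.

Lemma walk_mean_bound n G K :
  (forall s y, `|y| <= 1 -> `|G s y| <= K) -> `|U n G| <= K.
Proof.
move=> GK; rewrite ler_norml -{1}(walk_mean_cst n (- K)) -[X in _ && (_ <= X)](walk_mean_cst n K).
apply/andP; split; apply: walk_mean_le => s y y1;
  by have := GK s y y1; rewrite ler_norml => /andP[].
Qed.

(** The telescoping sum of the Lindeberg method: each one-step defect is carried along by the
    remaining transitions, which do not increase the supremum over [|y| <= 1]. *)
Lemma walk_mean_telescope n (V : nat -> R -> R -> R) K : (0 < n)%N ->
  (forall k s y, (0 < k < n)%N -> `|y| <= 1 -> `|step (V k.+1) s y - V k s y| <= K) ->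
  `|U n (V n) - V 1%N x0 x0| <= n.-1%:R * K.
Proof.
move=> n0 VK; rewrite /walk_mean.
(* Generalised to a start at time [i] in any state, for induction on the number [j] of remaining
   steps. *)
suff h j i s y : (0 < i)%N -> (i + j)%N = n -> `|y| <= 1 ->
    `|iter j step (V n) s y - V i s y| <= j%:R * K.
  by apply: h => //; rewrite add1n prednK.
elim: j i s y => [|j IH] i s y i0 ij y1.
  by rewrite -ij addn0 subrr normr0 mul0r.
rewrite iterS -(subrKA (step (V i.+1) s y)) -natr1 mulrDl mul1r.
apply: le_trans (ler_normD _ _) _; apply: lerD.
  by apply: step_close => // z z1; apply: IH => //; rewrite addSnnS.
by apply: VK => //; rewrite i0 -ij -addn1 leq_add2l.
Qed.

Lemma walk_mean_martingale n (V : nat -> R -> R -> R) : (0 < n)%N ->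
  (forall k s y, step (V k.+1) s y = V k s y) -> U n (V n) = V 1%N x0 x0.
Proof.
move=> n0 VK; apply/eqP; rewrite -subr_eq0 -normr_le0.
rewrite -(mulr0 n.-1%:R); apply: walk_mean_telescope => // k s y _ _.
by rewrite VK subrr normr0.
Qed.

(** Given [X_n = y], the next step has mean [a * (x0 + y)] and, since [x0^2 = 1], second moment
    [b * (1 + y^2)]. *)
Let a : R := (p - q) / 2.
Let b : R := (p + q) / 2.
(** The value of [b * (1 + X^2) - a^2 * (x0 + X)^2] averaged in the stationary regime, where [X] has
    mean [a x0 / (1 - a)] and second moment [b / (1 - b)]. *)
Definition asym_var : R := (b - a ^+ 2) / (1 - b) - 2 * a ^+ 3 / (1 - a).
Let s0 : R := asym_var.
Let M (k : nat) s y := (1 - a) * s + a * y - a * x0 * k%:R.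

(* Solution of the Poisson equation for the conditional variance of the
   martingale increments. *)
Let g y := - 2 * a ^+ 2 * x0 / (1 - a) * y + (b - a ^+ 2) / (1 - b) * y ^+ 2.
Let Cg := `| 2 * a ^+ 2 / (1 - a) | + `| (b - a ^+ 2) / (1 - b) |.

Let a1 : 0 < 1 - a. Proof. rewrite /a; plra. Qed.
Let b1 : 0 < 1 - b. Proof. rewrite /b; plra. Qed.
Let na : `|a| <= 1 / 2. Proof. rewrite ler_norml /a; plra. Qed.

(** The number [b] separates the two terms: [a^2 <= b^2] puts the first one above [b], and
    [|a| < b < 1 / 2] puts the second one strictly below it. *)
Lemma asym_var_gt0 : 0 < asym_var.
Proof.
have ba : `|a| < b by rewrite ltr_norml /a /b; plra.
have b0 : 0 < b := le_lt_trans (normr_ge0 a) ba.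
have b2 : b < 1 / 2 by rewrite /b; plra.
rewrite subr_gt0.
apply: (@lt_le_trans _ _ b); last first.
  rewrite ler_pdivlMr//; have : a ^+ 2 <= b ^+ 2.
    by rewrite -real_normK ?num_real// lerXn2r ?nnegrE ?(ltW b0)// ltW.
  by lra.
rewrite ltr_pdivrMr//.
have [an|ap] := leP a 0.
  apply: (@le_lt_trans _ _ 0); last by rewrite mulr_gt0.
  by rewrite pmulr_rle0// exprn_odd_le0.
rewrite (gtr0_norm ap) in ba.
have : a ^+ 2 < 1 / 4 by nra.
by move=> a2; rewrite exprS; nra.
Qed.

Let g_bound y : `|y| <= 1 -> `|g y| <= Cg.
Proof.
move=> y1; rewrite /g /Cg; apply: le_trans (ler_normD _ _) _; apply: lerD.
  rewrite normrM -[leRHS]mulr1; apply: ler_pM => //.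
  case: x01 => ->; rewrite ?mulr1 ?mulrN1 ?mulNr ?opprK ?normrN//.
rewrite normrM -[leRHS]mulr1; apply: ler_pM => //.
by rewrite normrX exprn_ile1.
Qed.

(** On functions quadratic in the new step only its first two conditional moments matter. The
    coefficients may depend on [s] and [y], so the conditional identities below become polynomial
    algebra. *)
Let step_quad (c0 c1 c2 : R) G s y :
  (forall z, G (s + z) z = c0 + c1 * z + c2 * z ^+ 2) ->
  step G s y = c0 + c1 * (a * (x0 + y)) + c2 * (b * (1 + y ^+ 2)).
Proof.
have rE : r = 1 - p - q by plra.
move=> Gz; have Gs : G s 0 = c0 by rewrite -{1}[s]addr0 Gz; ring.
rewrite /walk_step Gs !Gz rE /a /b.
by case: x01 => ->; field.
Qed.

Let a1f : 1 - a != 0. Proof. by rewrite gt_eqF. Qed.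
Let b1f : 1 - b != 0. Proof. by rewrite gt_eqF. Qed.

Let stepM k s y : step (M k.+1) s y = M k s y.
Proof.
rewrite (@step_quad (M k s y - a * (x0 + y)) 1 0); first by ring.
by move=> z; rewrite /M -natr1; ring.
Qed.

Let al := - 2 * a ^+ 2 * x0 / (1 - a).
Let be := (b - a ^+ 2) / (1 - b).

(* Second-order expansion of the step operator; [A], [A1], [A2] play the
   role of the jet of a test function at [M k s y]. *)
Let step_jet k s y (A A1 A2 e : R) :
  step (fun s' y' => A + e * (M k.+1 s' y' - M k s y) * A1
     + (e * (M k.+1 s' y' - M k s y)) ^+ 2 / 2 * A2 + e ^+ 2 / 2 * A2 * g y') s y =
  A + e ^+ 2 / 2 * A2 * (s0 + g y).
Proof.
pose w := a * (x0 + y).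
rewrite (@step_quad (A - e * w * A1 + e ^+ 2 * w ^+ 2 / 2 * A2)
  (e * A1 - e ^+ 2 * w * A2 + e ^+ 2 / 2 * A2 * al)
  (e ^+ 2 / 2 * A2 * (1 + be))).
  rewrite /w /s0 /asym_var /al /be /g -/a -/b.
  by case: x01 => ->; field; rewrite a1f b1f.
move=> z; have -> : M k.+1 (s + z) z - M k s y = z - w.
  by rewrite /M /w -natr1; ring.
by rewrite /g -/al -/be; field.
Qed.

Let stepM2 k s y : step (fun s y => M k.+1 s y ^+ 2 + g y - s0 * k.+1%:R) s y =
  M k s y ^+ 2 + g y - s0 * k%:R.
Proof.
pose w := a * (x0 + y); pose m := M k s y.
rewrite (@step_quad (m ^+ 2 - 2 * m * w + w ^+ 2 - s0 * k.+1%:R)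
  (2 * m - 2 * w + al) (1 + be)).
  rewrite /w /s0 /asym_var /al /be /g -/a -/b -/m -natr1.
  by case: x01 => ->; field; rewrite a1f b1f.
move=> z; have -> : M k.+1 (s + z) z = m + (z - w).
  by rewrite /m /M /w -natr1; ring.
by rewrite /g -/al -/be; ring.
Qed.

Let c y := b * (1 + y ^+ 2) - a ^+ 2 * (x0 + y) ^+ 2.

Let stepMy k s y : step (fun s y => M k.+1 s y * y) s y =
  a * (M k s y * y) + a * x0 * M k s y + c y.
Proof.
pose w := a * (x0 + y); pose m := M k s y.
rewrite (@step_quad 0 (m - w) 1).
  by rewrite /w /c -/m; ring.
move=> z; have -> : M k.+1 (s + z) z = m + (z - w).
  by rewrite /m /M /w -natr1; ring.
by ring.
Qed.

Let M1 : M 1 x0 x0 = (1 - a) * x0. Proof. by rewrite /M; ring. Qed.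

Lemma walk_mean_ext n G H : (forall s y, G s y = H s y) -> U n G = U n H.
Proof.
move=> GH; congr (U n _).
by apply/funext => s; apply/funext => y.
Qed.

Let UM n : (0 < n)%N -> U n (M n) = (1 - a) * x0.
Proof. by move=> n0; rewrite -M1; exact: walk_mean_martingale. Qed.

(** By [stepMy] these expectations satisfy an affine recursion with factor [a], where
    [|a| <= 1 / 2], and the bound 8 is preserved because [8 / 2 + 1 + 2 <= 8]. A Cauchy-Schwarz
    bound would only give order [sqrt n], too weak for the bounded error in [walk_variance]. *)
Let UMy n : (0 < n)%N -> `|U n (fun s y => M n s y * y)| <= 8.
Proof.
have ax : `|a * x0| <= 1 / 2 by rewrite normrM -[leRHS]mulr1 ler_pM.
have a1' : `|(1 - a) * x0| <= 2.
  rewrite normrM; apply: (@le_trans _ _ (2 * 1)); last by rewrite mulr1.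
  apply: ler_pM => //; have := na; rewrite !ler_norml; lra.
have b2 : 0 <= b <= 1 / 2 by rewrite /b; plra.
elim: n => // -[|n] IH _.
  rewrite -[U _ _]/(M 1 x0 x0 * x0) M1 normrM.
  by apply: (@le_trans _ _ (2 * 1)); [exact: ler_pM|lra].
rewrite walk_meanS//.
rewrite (@walk_mean_ext _ _ (fun s y => 1 * (a * (M n.+1 s y * y) + a * x0 * M n.+1 s y) + 1 * c y)); last first.
  by move=> s y; rewrite stepMy; ring.
rewrite !walk_mean_lin UM// !mul1r.
have cb : `|U n.+1 (fun _ y => c y)| <= 2.
  apply: walk_mean_bound => s y y1; rewrite /c.
  have y2 : y ^+ 2 <= 1 by rewrite -real_normK ?num_real// exprn_ile1.
  have xy : (x0 + y) ^+ 2 <= 4.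
    have : `|x0 + y| <= 2 by apply: le_trans (ler_normD _ _) _; have := x0n; lra.
    rewrite -(real_normK (num_real (x0 + y))); have := normr_ge0 (x0 + y); nra.
  have a2 : a ^+ 2 <= 1 / 4.
    rewrite -(real_normK (num_real a)); have := normr_ge0 a; have := na; nra.
  have := sqr_ge0 a; have := sqr_ge0 (x0 + y); have := sqr_ge0 y => *.
  rewrite ler_norml; nra.
have {}IH := IH isT.
apply: le_trans (ler_normD _ _) _.
apply: (@le_trans _ _ (1 / 2 * 8 + 1 / 2 * 2 + 2)); last by lra.
apply: lerD => //; apply: le_trans (ler_normD _ _) _.
by apply: lerD; rewrite normrM; apply: ler_pM.
Qed.


Lemma walk_variance : exists C, forall n, (0 < n)%N ->
  `|(1 - a) ^+ 2 * (U n (fun s _ => s ^+ 2) - U n (fun s _ => s) ^+ 2)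
    - s0 * n%:R| <= C.
Proof.
pose d0 := M 1 x0 x0 ^+ 2 + g x0 - s0 * 1.
(* One summand for each term of the identity derived below, in which the drift [a x0 n] has
   cancelled. *)
exists (`|d0| + Cg + 16 + 1 + 9) => n n0.
have e1 : (1 - a) * U n (fun s _ => s) =
    (1 - a) * x0 - a * U n (fun _ y => y) + a * x0 * n%:R.
  rewrite -(UM n0).
  transitivity (U n (fun s y => 1 * (1 * M n s y + (- a) * y) + (a * x0 * n%:R) * 1)).
    transitivity (U n (fun s y => (1 - a) * s + 0 * y)).
      by rewrite walk_mean_lin mul0r addr0.
    by apply: walk_mean_ext => s y; rewrite /M; ring.
  by rewrite !walk_mean_lin walk_mean_cst; ring.
have e2 : (1 - a) ^+ 2 * U n (fun s _ => s ^+ 2) =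
    U n (fun s y => M n s y ^+ 2) - 2 * a * U n (fun s y => M n s y * y)
    + a ^+ 2 * U n (fun _ y => y ^+ 2) - (a * x0 * n%:R) ^+ 2
    + 2 * (a * x0 * n%:R) * ((1 - a) * U n (fun s _ => s)).
  pose cc := a * x0 * n%:R; rewrite -/cc.
  transitivity (U n (fun s y => 1 * (1 * (1 * (1 * M n s y ^+ 2 + (- 2 * a) * (M n s y * y))
      + a ^+ 2 * y ^+ 2) + (- cc ^+ 2) * 1) + (2 * cc * (1 - a)) * s)).
    transitivity (U n (fun s y => (1 - a) ^+ 2 * s ^+ 2 + 0 * y)).
      by rewrite walk_mean_lin mul0r addr0.
    by apply: walk_mean_ext => s y; rewrite /M /cc; ring.
  by rewrite !walk_mean_lin walk_mean_cst; ring.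
have e3 : U n (fun s y => M n s y ^+ 2) = d0 + s0 * n%:R - U n (fun _ y => g y).
  have := @walk_mean_martingale n (fun k s y => M k s y ^+ 2 + g y - s0 * k%:R) n0 stepM2.
  rewrite -/d0 => <-.
  rewrite (@walk_mean_ext _ (fun s y => M n s y ^+ 2 + g y - s0 * n%:R)
    (fun s y => 1 * (1 * M n s y ^+ 2 + 1 * g y) + (- (s0 * n%:R)) * 1)); last first.
    by move=> s y; ring.
  by rewrite !walk_mean_lin walk_mean_cst; ring.
set m1 := U n (fun s _ => s) in e1 *; set m2 := U n (fun s _ => s ^+ 2) in e2 *.
set m := U n (fun _ y => y) in e1 *.
have -> : (1 - a) ^+ 2 * (m2 - m1 ^+ 2) - s0 * n%:R =
    d0 - U n (fun _ y => g y) - 2 * a * U n (fun s y => M n s y * y)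
    + a ^+ 2 * U n (fun _ y => y ^+ 2) - ((1 - a) * x0 - a * m) ^+ 2.
  rewrite mulrBr e2 e3 -exprMn e1; ring.
have bm : `|m| <= 1 by apply: walk_mean_bound.
have b2 : `|U n (fun _ y => y ^+ 2)| <= 1.
  by apply: walk_mean_bound => s y y1; rewrite normrX exprn_ile1.
have bg : `|U n (fun _ y => g y)| <= Cg.
  by apply: walk_mean_bound => s y; exact: g_bound.
have bMy := UMy n0.
have nna := na.
have h1 : `|2 * a * U n (fun s y => M n s y * y)| <= 2 * (1 / 2) * 8.
  by rewrite normrM; apply: ler_pM => //; rewrite normrM ger0_norm// ler_pM2l.
have h2 : `|a ^+ 2 * U n (fun _ y => y ^+ 2)| <= 1.
  rewrite normrM -[leRHS]mulr1; apply: ler_pM => //.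
  by rewrite normrX exprn_ile1//; lra.
have h3 : `|((1 - a) * x0 - a * m) ^+ 2| <= 3 ^+ 2.
  rewrite normrX; apply: lerXn2r; rewrite ?nnegrE//.
  apply: le_trans (ler_normB _ _) _; rewrite (normrM (1 - a)) (normrM a).
  have k1 : `|1 - a| * `|x0| <= (3 / 2) * 1.
    by apply: ler_pM => //; apply: le_trans (ler_normB _ _) _; rewrite normr1; lra.
  have k2 : `|a| * `|m| <= (1 / 2) * 1 by apply: ler_pM.
    by apply: le_trans (lerD k1 k2) _; lra.
apply: le_trans (ler_normB _ _) _; apply: lerD; last by lra.
apply: le_trans (ler_normD _ _) _; apply: lerD => //.
apply: le_trans (ler_normB _ _) _; apply: lerD; last by lra.
by apply: le_trans (ler_normB _ _) _; apply: lerD.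
Qed.

(* One Lindeberg step: replacing one increment of the martingale by a
   Gaussian of the stationary variance. The corrector [g] absorbs the
   fluctuation of the conditional variance, so that only an error of third
   order remains. *)
Lemma lindeberg_step B f f1 f2 (e : R) k s y (w := e * Num.sqrt s0) :
  0 < e -> jet B f f1 f2 -> `|y| <= 1 ->
  `|step (fun s y => f (e * M k.+1 s y) + e ^+ 2 / 2 * f2 (e * M k.+1 s y) * g y) s y
    - (gconv w f (e * M k s y) + e ^+ 2 / 2 * gconv w f2 (e * M k s y) * g y)|
  <= B * (8 + Cg + 58 * Num.sqrt s0 ^+ 3 + 29 * Cg * Num.sqrt s0) * e ^+ 3.
Proof.
move=> e0 fj y1; have [[L0 L1 L2] [B0 B1 B2] T] := fj.
have Bp : 0 <= B by exact: le_trans (B0 0).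
have s0p : 0 < s0 := asym_var_gt0.
set kp := Num.sqrt s0; have kp0 : 0 < kp by rewrite sqrtr_gt0.
have kp2 : kp ^+ 2 = s0 by rewrite sqr_sqrtr// ltW.
have w0 : 0 < w by rewrite mulr_gt0.
have Cg0 : 0 <= Cg by rewrite addr_ge0.
set z := e * M k s y.
set A := step _ _ _.
(* The common second-order expansion of both sides: of the walk side by [step_jet], of the Gaussian
   side because [w^2 = e^2 s0]. *)
pose A' := f z + e ^+ 2 / 2 * f2 z * (s0 + g y).
have hA : `|A - A'| <= B * (8 + Cg) * e ^+ 3.
  rewrite /A' -(step_jet k s y (f z) (f1 z) (f2 z) e).
  apply: step_close => // v v1.
  set D := M k.+1 (s + v) v - M k s y.
  have DE : D = v - a * (x0 + y) by rewrite /D /M -natr1; ring.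
  have xn := x0n; have nna := na.
  have D2 : `|D| <= 2.
    rewrite DE; apply: le_trans (ler_normB _ _) _; rewrite normrM.
    have : `|a| * `|x0 + y| <= (1 / 2) * 2.
      by apply: ler_pM => //; apply: le_trans (ler_normD _ _) _; lra.
    lra.
  have -> : e * M k.+1 (s + v) v = z + e * D by rewrite /z /D; ring.
  have t1 := T z (e * D); have t2 := L2 z (e * D).
  have eD : `|e * D| <= 2 * e by rewrite normrM (gtr0_norm e0) mulrC ler_pM2r.
  have eD3 : `|e * D| ^+ 3 <= 8 * e ^+ 3.
    apply: (@le_trans _ _ ((2 * e) ^+ 3)); last by rewrite exprMn; lra.
    by apply: lerXn2r; rewrite ?nnegrE//; apply: mulr_ge0 => //; exact: ltW.
  rewrite [X in `|X|](_ : _ =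
    (f (z + e * D) - (f z + e * D * f1 z + (e * D) ^+ 2 / 2 * f2 z))
    + e ^+ 2 / 2 * ((f2 (z + e * D) - f2 z) * g v)); last by ring.
  rewrite [leRHS](_ : _ = B * 8 * e ^+ 3 + B * Cg * e ^+ 3); last by ring.
  apply: le_trans (ler_normD _ _) _; apply: lerD.
    by apply: le_trans t1 _; rewrite -mulrA ler_wpM2l.
  rewrite normrM ger0_norm; last by rewrite divr_ge0 ?sqr_ge0.
  have -> : B * Cg * e ^+ 3 = e ^+ 2 / 2 * (B * (2 * e) * Cg) by field.
  apply: ler_wpM2l; first by rewrite divr_ge0 ?sqr_ge0.
  rewrite normrM; apply: ler_pM => //; last exact: g_bound.
  by apply: le_trans t2 _; rewrite ler_wpM2l.
(* The average of [f2] is multiplied by [e^2], so a first-order estimate of it already has an error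
   of order [e^3]. *)
have c1 := jet_gconv_taylor z w0 fj.
have c2 := gconv_close z w0 L2 B2.
have w2 : w ^+ 2 = e ^+ 2 * s0 by rewrite exprMn -/kp kp2.
rewrite (_ : A - _ = (A - A') - ((gconv w f z - (f z + w ^+ 2 / 2 * f2 z))
    + e ^+ 2 / 2 * ((gconv w f2 z - f2 z) * g y))); last first.
  by rewrite w2 /A'; ring.
have -> : B * (8 + Cg + 58 * kp ^+ 3 + 29 * Cg * kp) * e ^+ 3 =
   B * (8 + Cg) * e ^+ 3 + (58 * B * w ^+ 3 + e ^+ 2 / 2 * (58 * B * w * Cg)).
  by rewrite /w -/kp; field.
apply: le_trans (ler_normB _ _) _; apply: lerD => //.
apply: le_trans (ler_normD _ _) _; apply: lerD => //.
rewrite normrM ger0_norm; last by rewrite divr_ge0 ?sqr_ge0.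
apply: ler_wpM2l; first by rewrite divr_ge0 ?sqr_ge0.
by rewrite normrM; apply: ler_pM => //; exact: g_bound.
Qed.

Lemma walk_mean_close n G H K :
  (forall s y, `|y| <= 1 -> `|G s y - H s y| <= K) -> `|U n G - U n H| <= K.
Proof.
move=> GH; have -> : U n G - U n H = U n (fun s y => 1 * G s y + (-1) * H s y).
  by rewrite walk_mean_lin; ring.
by apply: walk_mean_bound => s y y1; rewrite mul1r mulN1r; exact: GH.
Qed.

Definition lim_var : R := asym_var / (1 - (p - q) / 2) ^+ 2.

Lemma lim_var_gt0 : 0 < lim_var.
Proof. by rewrite divr_gt0 ?exprn_gt0// asym_var_gt0. Qed.

Let sqrt_lim_var : Num.sqrt lim_var = Num.sqrt s0 / (1 - a).
Proof.
rewrite /lim_var sqrtrM; last by rewrite ltW// asym_var_gt0.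
by rewrite sqrtrV ?exprn_ge0 ?(ltW a1)// sqrtr_sqr gtr0_norm.
Qed.

Lemma walk_clt_smooth B f f1 f2 : jet B f f1 f2 ->
  exists C, forall n, (0 < n)%N ->
  `|U n (fun s _ => f ((s - n%:R * ((p - q) * x0 / (2 + q - p))) / Num.sqrt n%:R))
    - gmean (Num.sqrt lim_var) f| <= C / Num.sqrt n%:R.
Proof.
move=> fj; have [[L0 L1 L2] [B0 B1 B2] T] := fj.
have Bp : 0 <= B by exact: le_trans (B0 0).
have s0p : 0 < s0 := asym_var_gt0.
set kp := Num.sqrt s0; have kp0 : 0 < kp by rewrite sqrtr_gt0.
have Cg0 : 0 <= Cg by rewrite addr_ge0.
pose K := B * (8 + Cg + 58 * kp ^+ 3 + 29 * Cg * kp).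
have K0 : 0 <= K.
  by rewrite mulr_ge0// !addr_ge0// mulr_ge0 ?mulr_ge0 ?exprn_ge0// ltW.
(* The three groups pay for [stop], [tel] and [start], in this order. *)
exists ((B * 2 + 116 * B * kp + 2 * B * Cg) + 8 * K + (2 * B + 2 * B * Cg)) => n n0.
set rn := Num.sqrt n%:R.
have rn2 : rn ^+ 2 = n%:R by rewrite sqr_sqrtr.
have rn1 : 1 <= rn by rewrite -sqrtr1 ler_wsqrtr// ler1n.
have rn0 : 0 < rn by lra.
have rn1' : rn^-1 <= 1 by rewrite invf_le1.
have rnp : 0 < rn^-1 by rewrite invr_gt0.
pose e := ((1 - a) * rn)^-1.
have e0 : 0 < e by rewrite invr_gt0 mulr_gt0.
have e2 : e <= 2 * rn^-1.
  rewrite /e invfM ler_pM2r// -[leRHS]invrK lef_pV2 ?posrE ?invr_gt0//.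
  by have := na; rewrite ler_norml; lra.
have ee : e ^+ 2 <= 4 * rn^-1.
  apply: (@le_trans _ _ ((2 * rn^-1) ^+ 2)); first by apply: lerXn2r; rewrite ?nnegrE; lra.
  by rewrite exprMn; nra.
have eee : n.-1%:R * e ^+ 3 <= 8 * rn^-1.
  apply: (@le_trans _ _ (n%:R * (2 * rn^-1) ^+ 3)).
    apply: ler_pM => //; first by rewrite exprn_ge0// ltW.
      by rewrite ler_nat leq_pred.
    by apply: lerXn2r; rewrite ?nnegrE; lra.
  by rewrite -rn2 le_eqVlt; apply/orP; left; apply/eqP; field; rewrite gt_eqF.
(* One unit of variance more than the [n - k] remaining steps: all deviations stay positive up to
   [k = n], and [w 1] is exactly the limiting deviation. *)
pose w k := e * kp * Num.sqrt (n.+1 - k)%:R.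
pose V k s y := gconv (w k) f (e * M k s y) + e ^+ 2 / 2 * gconv (w k) f2 (e * M k s y) * g y.
have tel : `|U n (V n) - V 1%N x0 x0| <= n.-1%:R * (K * e ^+ 3).
  apply: walk_mean_telescope => // k s y /andP[k0 kn] y1.
  have wk0 : 0 < w k.+1 by rewrite !mulr_gt0// sqrtr_gt0 ltr0n subSS subn_gt0.
  have wk : 0 < w k by rewrite !mulr_gt0// sqrtr_gt0 ltr0n subn_gt0 ltnW.
  have ekp : 0 < e * kp by rewrite mulr_gt0.
  have ws : w k ^+ 2 = (e * kp) ^+ 2 + w k.+1 ^+ 2.
    rewrite /w !exprMn !sqr_sqrtr ?(ltW s0p)// subSS subSn; last exact: ltnW.
    by rewrite -natr1; ring.
  (* The step lemma is applied to the average of [f] at deviation [w k.+1], whose jet has the same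
     bound [B]; the semigroup law then merges the two averages into [V k]. *)
  have := lindeberg_step k s e0 (jet_gconv (w k.+1) fj) y1.
  by rewrite -/s0 -/kp !(gconv_conv _ ekp wk0 wk ws L0 B0, gconv_conv _ ekp wk0 wk ws L2 B2)//; apply.
have wn : w n = e * kp by rewrite /w subSnn sqrtr1 mulr1.
have w1 : w 1%N = Num.sqrt lim_var.
  rewrite sqrt_lim_var -/kp /w subn1/= -/rn /e; field.
  by rewrite !gt_eqF.
have ek0 : 0 < e * kp by rewrite mulr_gt0.
have start : `|V 1%N x0 x0 - gmean (Num.sqrt lim_var) f|
    <= B * rn^-1 + e ^+ 2 / 2 * (B * Cg).
  have eM : e * M 1 x0 x0 = x0 * rn^-1.
    by rewrite M1 /e; field; rewrite !gt_eqF.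
  rewrite /V w1 eM.
  have -> : gmean (Num.sqrt lim_var) f = gconv (Num.sqrt lim_var) f 0.
    by rewrite /gconv; congr gmean; apply/funext => z; rewrite add0r.
  rewrite addrAC; apply: le_trans (ler_normD _ _) _; apply: lerD.
    have := gconv_lip (Num.sqrt lim_var) L0 B0 0 (x0 * rn^-1).
    rewrite add0r => /le_trans; apply; rewrite ler_wpM2l//.
    rewrite normrM (gtr0_norm rnp) ger_pMl//.
  rewrite -mulrA normrM ger0_norm; last by rewrite divr_ge0 ?sqr_ge0.
  apply: ler_wpM2l; first by rewrite divr_ge0 ?sqr_ge0.
  rewrite normrM; apply: ler_pM => //; last exact: g_bound.
  exact: gconv_bounded L2 B2.
have stop : `|U n (fun s _ => f ((s - n%:R * ((p - q) * x0 / (2 + q - p))) / rn))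
    - U n (V n)| <= B * e + 58 * B * (e * kp) + e ^+ 2 / 2 * (B * Cg).
  apply: walk_mean_close => s y y1; rewrite /V wn.
  set u := (s - _) / rn.
  (* This is where the centring comes from: [(p - q) / (2 + q - p) = a / (1 - a)]. *)
  have eM : e * M n s y = u + e * a * y.
    rewrite /u /M /e /a; field.
    by rewrite !gt_eqF//; move: a1; rewrite /a; plra.
  rewrite eM; set z := u + _.
  rewrite (_ : f u - _ = (- (f z - f u)) - (gconv (e * kp) f z - f z)
     - e ^+ 2 / 2 * (gconv (e * kp) f2 z * g y)); last by ring.
  apply: le_trans (ler_normB _ _) _; apply: lerD.
    apply: le_trans (ler_normB _ _) _; apply: lerD.
      rewrite normrN; apply: le_trans (L0 _ _) _; rewrite ler_wpM2l//.
      rewrite normrM normrM (gtr0_norm e0) -mulrA ger_pMr//.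
      by rewrite -[leRHS]mulr1; apply: ler_pM => //; have := na; lra.
    exact: gconv_close L0 B0.
  rewrite normrM ger0_norm; last by rewrite divr_ge0 ?sqr_ge0.
  apply: ler_wpM2l; first by rewrite divr_ge0 ?sqr_ge0.
  rewrite normrM; apply: ler_pM => //; last exact: g_bound.
  exact: gconv_bounded L2 B2.
rewrite -(subrKA (U n (V n))) -(subrKA (V 1%N x0 x0) (U n (V n))).
apply: le_trans (ler_normD _ _) _; rewrite addrC.
apply: (@le_trans _ _ (B * e + 58 * B * (e * kp) + e ^+ 2 / 2 * (B * Cg) +
   (n.-1%:R * (K * e ^+ 3) + (B * rn^-1 + e ^+ 2 / 2 * (B * Cg))))).
  rewrite addrC; apply: lerD => //.
  by apply: le_trans (ler_normD _ _) _; apply: lerD.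
have BC : 0 <= B * Cg by rewrite mulr_ge0.
have t1 : B * e <= B * (2 * rn^-1) by rewrite ler_wpM2l.
have t2 : 58 * B * (e * kp) <= 116 * B * kp * rn^-1.
  have -> : 116 * B * kp * rn^-1 = 58 * B * (2 * rn^-1 * kp) by ring.
  by rewrite ler_wpM2l ?mulr_ge0// ler_pM2r.
have t3 : e ^+ 2 / 2 * (B * Cg) <= 2 * B * Cg * rn^-1.
  have -> : 2 * B * Cg * rn^-1 = (4 * rn^-1) / 2 * (B * Cg) by field; rewrite gt_eqF.
  by rewrite ler_wpM2r// ler_pM2r.
have t4 : n.-1%:R * (K * e ^+ 3) <= 8 * K * rn^-1.
  by rewrite mulrCA -mulrA [leRHS]mulrCA ler_wpM2l.
have t5 : 0 <= B * rn^-1 by rewrite mulr_ge0// ltW.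
rewrite mulrDl mulrDl mulrDl mulrDl mulrDl.
by lra.
Qed.

End walk.

(** * From smooth test functions to distribution functions *)

Section normal_cdf.
Context {R : realType}.
Notation mu := (@lebesgue_measure R).

Lemma normal_cdf_int (v x : R) : 0 < v ->
  gauss_int (Num.sqrt v) (fun z => (z <= x)%R%:R) (normal_cdf v x).
Proof.
move=> v0; rewrite /normal_cdf gt_eqF//.
have mi : measurable_fun setT (fun z : R => (z <= x)%R%:R : R).
  rewrite (_ : (fun z => _) = \1_(`]-oo, x] : set R)); last first.
    by apply/funext => z; rewrite indicE mem_setE in_itv.
  exact: measurable_indic.
have ii : gauss_able (Num.sqrt v) (fun z => (z <= x)%R%:R).
  by apply: (@gauss_able_bounded _ _ _ 1) => // z; case: (z <= x); rewrite ?normr1 ?normr0.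
have := gmeanP ii; congr gauss_int.
rewrite /gmean /Rintegral /normal_prob [in RHS]integral_mkcond; congr fine.
apply: eq_integral => z _; rewrite patchE mem_setE in_itv/=.
by case: (z <= x); rewrite ?mul1r ?mul0r.
Qed.

(** The density never exceeds its peak. This bounds the cost of shifting a half-line by the width of
    the spline transition. *)
Lemma normal_cdf_lip (v x h : R) : 0 < v -> 0 <= h ->
  normal_cdf v (x + h) <= normal_cdf v x + normal_peak (Num.sqrt v) * h.
Proof.
move=> v0 h0; rewrite -lerBlDl.
have i1 := gaussB (normal_cdf_int (x + h) v0) (normal_cdf_int x v0).
have i2 : has_int mu (fun z => normal_peak (Num.sqrt v) * \1_(`]x, x + h] : set R) z)
   (normal_peak (Num.sqrt v) * h).
  apply: has_intZ; split; first exact: integrable_indic_itv.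
  rewrite integral_indic// setIT.
  transitivity (lebesgue_measure (`]x, x + h] : set R)); first by [].
  rewrite lebesgue_measure_itv/= lte_fin.
  case: ltP => [_|xh]; first by rewrite -EFinB addrAC subrr add0r.
  by congr EFin; lra.
apply: has_int_le i1 i2 => z; rewrite indicE mem_setE in_itv/=.
have s0 : Num.sqrt v != 0 by rewrite gt_eqF// sqrtr_gt0.
case: (leP z x) => zx; case: (leP z (x + h)) => zxh /=.
- by rewrite subrr mul0r mulr0.
- by exfalso; lra.
- by rewrite subr0 mul1r mulr1 normal_pdf_ub.
- by rewrite subrr mul0r mulr0.
Qed.

End normal_cdf.

Lemma near_inv_sqrt {R : realType} (C e : R) : 0 < e ->
  \forall n \near \oo, C / Num.sqrt n%:R <= e.
Proof.
move=> e0; near=> n.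
have n1 : (0 < n)%N by near: n; exact: nbhs_infty_gt.
have rn : 0 < Num.sqrt n%:R :> R by rewrite sqrtr_gt0 ltr0n.
rewrite ler_pdivrMr// mulrC -ler_pdivrMr//.
apply: le_trans (ler_norm _) _; rewrite -sqrtr_sqr; apply: ler_wsqrtr.
by near: n; exact: nbhs_infty_ger.
Unshelve. all: by end_near. Qed.

(** The indicator of [y <= x] lies between [spline (k (x - y))] and [spline (k (x + 3 / k - y))];
    both satisfy the smooth limit theorem, and their Gaussian averages are close to the distribution
    function at [x]. *)
Lemma walk_clt (R : realType) (p q r x0 x : R) :
  0 < p -> 0 < q -> 0 < r -> p + q + r = 1 -> x0 = 1 \/ x0 = -1 ->
  (fun n => walk_mean p q r x0 n (fun s _ =>
     ((s - n%:R * ((p - q) * x0 / (2 + q - p))) / Num.sqrt n%:R <= x)%R%:R)) @ \oo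
  --> normal_cdf (lim_var p q) x.
Proof.
move=> p0 q0 r0 pqr x01.
have v0 : 0 < lim_var p q := lim_var_gt0 p0 q0 r0 pqr.
set v := lim_var p q in v0 *; pose pk := normal_peak (Num.sqrt v).
have pk0 : 0 <= pk by exact: normal_peak_ge0.
apply/cvgrPdist_le => e e0.
(* Half of [e] pays for the smoothing, through [pk * (3 / k) <= e / 2], the other half for the rate
   of convergence; [k >= 1] is required by [jet_scale]. *)
pose k := Num.max 1 (6 * pk / e).
have k1 : 1 <= k by rewrite le_max lexx.
have k0 : 0 < k by lra.
have ke : pk * (3 / k) <= e / 2.
  have : 6 * pk / e <= k by rewrite le_max lexx orbT.
  rewrite ler_pdivrMr// => h.
  by rewrite mulrA ler_pdivrMr//; lra.
have k30 : 0 <= 3 / k by rewrite divr_ge0// ltW.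
have rg (t : R) : 0 <= spline t <= 1 by have [] := spline_range t.
have [C1 up] := walk_clt_smooth p0 q0 r0 pqr x01 (jet_scale (x + 3 / k) k1 spline_jet).
have [C2 lo] := walk_clt_smooth p0 q0 r0 pqr x01 (jet_scale x k1 spline_jet).
have gint c : gauss_int (Num.sqrt v) (fun y => spline (k * (c - y)))
    (gmean (Num.sqrt v) (fun y => spline (k * (c - y)))).
  have [[L _ _] [B _ _] _] := jet_scale c k1 (@spline_jet R).
  by apply/gmeanP/gauss_able_bounded; [exact: (lipB_measurable L)|exact: B].
have g1 : gmean (Num.sqrt v) (fun y => spline (k * (x + 3 / k - y))) <=
    normal_cdf v (x + 3 / k).
  apply: gauss_le (gint _) (normal_cdf_int _ v0) => y.
  have [yx|yx] := leP y (x + 3 / k); first by have /andP[] := rg (k * (x + 3 / k - y)).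
  by rewrite spline_eq0// pmulr_rle0//; lra.
have g2 : normal_cdf v (x - 3 / k) <= gmean (Num.sqrt v) (fun y => spline (k * (x - y))).
  apply: gauss_le (normal_cdf_int _ v0) (gint _) => y.
  have [yx|yx] := leP y (x - 3 / k); last by have /andP[] := rg (k * (x - y)).
  rewrite spline_eq1//; have : k * (3 / k) <= k * (x - y) by rewrite ler_pM2l//; lra.
  by rewrite mulrC divfK// gt_eqF.
have c1 := normal_cdf_lip x v0 k30.
have c2 := normal_cdf_lip (x - 3 / k) v0 k30; rewrite subrK -/pk in c1 c2.
have e20 : 0 < e / 2 by rewrite divr_gt0.
near=> n.
have n0 : (0 < n)%N by near: n; exact: nbhs_infty_gt.
have d1 : C1 / Num.sqrt n%:R <= e / 2 by near: n; exact: near_inv_sqrt.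
have d2 : C2 / Num.sqrt n%:R <= e / 2 by near: n; exact: near_inv_sqrt.
set u := walk_mean _ _ _ _ _ _.
have {}up := up n n0; have {}lo := lo n n0.
set u1 := walk_mean _ _ _ _ _ _ in up; set u2 := walk_mean _ _ _ _ _ _ in lo.
have l1 : u <= u1.
  apply: walk_mean_le => // s y _; set z := _ / Num.sqrt _.
  have [yx|yx] := leP z x; last by have /andP[] := rg (k * (x + 3 / k - z)).
  rewrite spline_eq1//; have : k * (3 / k) <= k * (x + 3 / k - z).
    by rewrite ler_pM2l//; lra.
  by rewrite mulrC divfK// gt_eqF.
have l2 : u2 <= u.
  apply: walk_mean_le => // s y _; set z := _ / Num.sqrt _.
  have [yx|yx] := leP z x; first by have /andP[] := rg (k * (x - z)).
  by rewrite spline_eq0// pmulr_rle0//; lra.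
move: up lo; rewrite !ler_norml -/v -/pk in c1 * => /andP[_ up] /andP[lo _].
by apply/andP; split; lra.
Unshelve. all: by end_near. Qed.

(** * The law of the elephant random walk *)

Section erw_path.
Context {R : realType}.
Implicit Types (x : R) (e : nat -> R) (k : nat -> nat).

Definition erw_last x e k n : R := nth 0 (erw_path x e k n) n.-1.

Lemma size_erw_path x e k n : size (erw_path x e k n) = n.
Proof. by elim: n => // -[//|n] IH; rewrite /= size_rcons IH. Qed.

Lemma erw_pathSS x e k n : erw_path x e k n.+2 =
  rcons (erw_path x e k n.+1)
    (e n.+2 * nth 0 (erw_path x e k n.+1) (if n == 0%N then 1%N else k n.+2).-1).
Proof. by []. Qed.

Lemma nth0_erw_path x e k n : nth 0 (erw_path x e k n.+1) 0 = x.
Proof. by elim: n => // n IH; rewrite erw_pathSS nth_rcons size_erw_path. Qed.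

Lemma erw_lastSS x e k n : erw_last x e k n.+2 =
  e n.+2 * nth 0 (erw_path x e k n.+1) (if n == 0%N then 1%N else k n.+2).-1.
Proof. by rewrite /erw_last erw_pathSS nth_rcons size_erw_path ltnn eqxx. Qed.

Lemma erw_sumSS x e k n :
  erw_sum x e k n.+2 = erw_sum x e k n.+1 + erw_last x e k n.+2.
Proof. by rewrite /erw_sum erw_lastSS erw_pathSS -cats1 big_cat big_seq1. Qed.

End erw_path.

(** * Measurability of the walk *)

Section measurability.
Context {R : realType} {d : measure_display} {T : measurableType d}.

Lemma measurable_eq_indic (A : eqType) (f : T -> A) c :
  measurable [set w | f w = c] -> measurable_fun setT (fun w => (f w == c)%:R : R).
Proof.
move=> mf; rewrite (_ : (fun _ => _) = \1_[set w | f w = c]).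
  exact: measurable_indic.
apply/funext => w; rewrite indicE; congr (nat_of_bool _)%:R.
by apply/eqP/idP; rewrite inE.
Qed.

(** A random index is handled by cutting the preimage into countably many pieces along the values of
    [K]. *)
Lemma measurable_fun_nat_comp (K : T -> nat) (F : nat -> T -> R) :
  (forall m, measurable [set w | K w = m]) ->
  (forall m, measurable_fun setT (F m)) ->
  measurable_fun setT (fun w => F (K w) w).
Proof.
move=> mK mF _ B mB; rewrite setTI.
rewrite (_ : _ @^-1` B = \bigcup_m ([set w | K w = m] `&` (F m @^-1` B))).
  apply: bigcupT_measurable => m; apply: measurableI => //.
  by rewrite -[X in measurable X]setTI; exact: mF.
apply/seteqP; split=> [w Bw|w [m _ [/= <-]]//].
by exists (K w).
Qed.

Variables (eta : nat -> T -> R) (K : nat -> T -> nat).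
Hypotheses (meta : forall i, measurable_fun setT (eta i))
  (mK : forall j m, measurable [set w | K j w = m]).

Lemma measurable_nth_erw_path (x : T -> R) n j : measurable_fun setT x ->
  measurable_fun setT (fun w => nth 0 (erw_path (x w) (eta ^~ w) (K ^~ w) n) j).
Proof.
move=> mx; elim: n j => [|[|n] IH] j.
- by rewrite (_ : (fun _ => _) = cst 0)//; apply/funext => w; rewrite /= nth_nil.
- by case: j => [|j] /=.
- under eq_fun do rewrite erw_pathSS nth_rcons size_erw_path.
  case: ltnP => _; first exact: IH.
  case: (eqVneq j n.+1) => _; last exact: measurable_cst.
  apply: measurable_funM; first exact: meta.
  case: (eqVneq n 0%N) => _; first exact: IH.
  apply: (@measurable_fun_nat_comp (K n.+2)
    (fun m w => nth 0 (erw_path (x w) (eta ^~ w) (K ^~ w) n.+1) m.-1)) => //.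
Qed.

Lemma measurable_erw_sum (x : T -> R) n : measurable_fun setT x ->
  measurable_fun setT (fun w => erw_sum (x w) (eta ^~ w) (K ^~ w) n).
Proof.
move=> mx; rewrite /erw_sum.
under eq_fun do rewrite (big_nth 0) size_erw_path.
apply: measurable_sum => i; exact: measurable_nth_erw_path.
Qed.

End measurability.

(** * From the joint law of the data to the Markov chain *)

Section joint_law.
Context {R : realType} {d : measure_display} {T : measurableType d}.
Variables (P : probability T R) (p q r : R).
Variables (X1 : T -> R) (eta : nat -> T -> R) (K : nat -> T -> nat).
Hypotheses (mX1 : measurable_fun setT X1)
  (meta : forall i, measurable_fun setT (eta i))
  (mK : forall j m, measurable [set w | K j w = m]).
Hypothesis law : forall (n : nat) (x1 : R) (e : nat -> R) (k : nat -> nat),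
  P [set w | X1 w = x1 /\ (forall i, (2 <= i <= n)%N -> eta i w = e i)
             /\ (forall j, (3 <= j <= n)%N -> K j w = k j)]
  = (pmf_step p q r x1 * \prod_(2 <= i < n.+1) pmf_step p q r (e i)
     * \prod_(3 <= j < n.+1) pmf_K R j (k j))%:E.

Let vals : seq R := [:: 1; -1; 0].

(** Indicator that the coordinates after time [n] take prescribed values; [futw] is its probability.
    The variables [K] start at index 3, hence the factor 1 for [i <= 2]. *)
Let fut (n N : nat) (e : nat -> R) (k : nat -> nat) (w : T) : R :=
  \prod_(n.+1 <= i < N.+1)
    ((eta i w == e i)%:R * (if (i <= 2)%N then 1 else (K i w == k i)%:R)).

Let futw (n N : nat) (e : nat -> R) (k : nat -> nat) : R :=
  \prod_(n.+1 <= i < N.+1)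
    (pmf_step p q r (e i) * (if (i <= 2)%N then 1 else pmf_K R i (k i))).

(** Indicator that the coordinates up to time [n] take admissible values. The laws guarantee this
    only almost surely, so the event is carried explicitly. *)
Let good (n : nat) (w : T) : R :=
  \prod_(2 <= i < n.+1)
    ((\sum_(v <- vals) (eta i w == v)%:R) *
     (if (i <= 2)%N then 1 else \sum_(m <- [:: 1%N; i.-1]) (K i w == m)%:R)).

Let mX1c (c : R) : measurable_fun setT (fun w => (X1 w == c)%:R : R).
Proof.
apply: measurable_eq_indic; rewrite -[X in measurable X]setTI.
exact: (mX1 _ (measurable_set1 c)).
Qed.

Let metac i (c : R) : measurable_fun setT (fun w => (eta i w == c)%:R : R).
Proof.
apply: measurable_eq_indic; rewrite -[X in measurable X]setTI.
exact: (meta _ _ (measurable_set1 c)).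
Qed.

Let mKc i m : measurable_fun setT (fun w => (K i w == m)%:R : R).
Proof. by apply: measurable_eq_indic; exact: mK. Qed.

Let mfut n N e k : measurable_fun setT (fut n N e k).
Proof.
rewrite /fut; apply: measurable_prod => i _.
apply: measurable_funM; first exact: metac.
by case: (i <= 2)%N; [exact: measurable_cst|exact: mKc].
Qed.

Let atom N (c : R) (e : nat -> R) (k : nat -> nat) :=
  [set w | X1 w = c /\ (forall i, (2 <= i <= N)%N -> eta i w = e i)
             /\ (forall j, (3 <= j <= N)%N -> K j w = k j)].

Let atomE N c e k w : (X1 w == c)%:R * fut 1 N e k w = \1_(atom N c e k) w.
Proof.
rewrite indicE /fut.
case: (boolP (w \in atom N c e k)) => [/set_mem[-> [he hk]]|].
  rewrite eqxx mul1r big_nat big1// => i /andP[i1 iN].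
  rewrite he ?i1//= eqxx mul1r; case: leqP => // i2.
  by rewrite hk ?eqxx// i2.
rewrite notin_setE => nA; apply/eqP/negPn/negP => n0; apply: nA.
move: n0; rewrite mulf_eq0 negb_or pnatr_eq0 eqb0 negbK => /andP[/eqP hX].
rewrite prodf_seq_neq0 => /allP h2; split=> //.
have hi i : (2 <= i <= N)%N -> eta i w = e i /\ ((2 < i)%N -> K i w = k i).
  move=> iN; have := h2 i; rewrite mem_index_iota ltnS => /(_ iN) /=.
  rewrite mulf_eq0 negb_or pnatr_eq0 eqb0 negbK => /andP[/eqP ei].
  by case: leqP => // _; rewrite pnatr_eq0 eqb0 negbK => /eqP.
split=> i iN; first by have [] := hi i iN.
have /andP[i3 iN'] := iN.
by have [|_] := hi i; [rewrite iN' (ltnW i3)|apply].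
Qed.

Let atom_int N c e k : has_int P (fun w => (X1 w == c)%:R * fut 1 N e k w)
  (pmf_step p q r c * futw 1 N e k).
Proof.
have mA : measurable (atom N c e k).
  rewrite (_ : atom N c e k = setT `&` (fun w => (X1 w == c)%:R * fut 1 N e k w) @^-1` [set 1]).
    by apply: measurable_funM => //.
  apply/seteqP; split=> w; rewrite setTI /= atomE indicE; first by move/mem_set ->.
  by case: (boolP (w \in _)) => [/set_mem//|_ /eqP]; rewrite eq_sym oner_eq0.
apply: (@has_int_ext _ _ _ _ (\1_(atom N c e k))); first by move=> w; rewrite atomE.
split.
  exact: integrable_indic.
rewrite integral_indic// setIT [LHS]law -mulrA; congr ((_ * _)%:E).
rewrite /futw big_split/=; congr (_ * _).
case: N {mA} => [|[|N]]; [by rewrite !big_geq|by rewrite !big_geq|].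
rewrite [RHS]big_ltn//= mul1r; apply: eq_big_nat => i /andP[i3 _].
by rewrite leqNgt i3.
Qed.

Section start.
Variables (c x0 : R).

Let S n w := erw_sum x0 (eta ^~ w) (K ^~ w) n.
Let X n w := erw_last x0 (eta ^~ w) (K ^~ w) n.
Local Notation U := (walk_mean p q r x0).

Definition upd (A : Type) (f : nat -> A) (i : nat) (v : A) : nat -> A :=
  fun j => if j == i then v else f j.

Let futS n N e k v m w : (n < N)%N ->
  fut n N (upd e n.+1 v) (upd k n.+1 m) w =
  ((eta n.+1 w == v)%:R * (if (n.+1 <= 2)%N then 1 else (K n.+1 w == m)%:R))
  * fut n.+1 N e k w.
Proof.
move=> nN; rewrite /fut big_ltn// /upd eqxx; congr (_ * _).
by apply: eq_big_nat => i /andP[/gtn_eqF -> _].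
Qed.

Let futwS n N e k v m : (n < N)%N ->
  futw n N (upd e n.+1 v) (upd k n.+1 m) =
  (pmf_step p q r v * (if (n.+1 <= 2)%N then 1 else pmf_K R n.+1 m))
  * futw n.+1 N e k.
Proof.
move=> nN; rewrite /futw big_ltn// /upd eqxx; congr (_ * _).
by apply: eq_big_nat => i /andP[/gtn_eqF -> _].
Qed.

Lemma pmf_step1 : pmf_step p q r 1 = p.
Proof. by rewrite /pmf_step eqxx. Qed.

Lemma pmf_stepN1 : pmf_step p q r (-1) = q.
Proof. by rewrite /pmf_step eqxx [-1 == _]eq_sym -addr_eq0 (pnatr_eq0 _ 2). Qed.

Lemma pmf_step0 : pmf_step p q r 0 = r.
Proof. by rewrite /pmf_step eq_sym oner_eq0 eq_sym oppr_eq0 oner_eq0 eqxx. Qed.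

(** Induction on [n]: summing over the values of coordinate [n + 1] moves it from [fut] to [good]
    and performs one transition of the chain. The still prescribed coordinates up to [N] keep the
    hypothesis on atoms applicable. The start [x0] is kept apart from the value [c] of [X1], which
    serves both [S_n] and [T_n]. *)
Lemma walk_law n N e k G : (0 < n <= N)%N ->
  has_int P (fun w => (X1 w == c)%:R * good n w * fut n N e k w * G (S n w) (X n w))
    (pmf_step p q r c * U n G * futw n N e k).
Proof.
elim: n N e k G => // -[|n] IH N e k G /andP[_ nN].
  have -> : pmf_step p q r c * U 1 G * futw 1 N e k =
     G x0 x0 * (pmf_step p q r c * futw 1 N e k) by rewrite /walk_mean/=; ring.
  apply: has_int_ext (has_intZ _ (atom_int _ _ _ _)) => w.
  by rewrite /good big_geq// /S /erw_sum /X /erw_last/= big_seq1; ring.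
set i := n.+2.
have goodS w : good i w = good n.+1 w * ((\sum_(v <- vals) (eta i w == v)%:R) *
   (if (i <= 2)%N then 1 else \sum_(m <- [:: 1%N; i.-1]) (K i w == m)%:R)).
  by rewrite {1}/good big_nat_recr.
have IH' v m H : has_int P (fun w => (X1 w == c)%:R * good n.+1 w *
     fut n.+1 N (upd e i v) (upd k i m) w * H (S n.+1 w) (X n.+1 w))
    (pmf_step p q r c * U n.+1 H * futw n.+1 N (upd e i v) (upd k i m)).
  by apply: IH; rewrite /= ltnW.
(* The second step involves no [K]; the index 0 given to [upd k] in this case is a dummy. *)
have [n0|n0] := eqVneq n 0%N.
  subst n; pose H v (s y : R) := G (s + v * y) (v * y).
  have := has_int_sum vals (fun v => IH' v 0%N (H v)).
  have -> : \sum_(v <- vals) pmf_step p q r c * U 1 (H v) *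
      futw 1 N (upd e i v) (upd k i 0%N) = pmf_step p q r c * U i G * futw i N e k.
    rewrite !big_cons big_nil !futwS// -/i /i/= pmf_step1 pmf_stepN1 pmf_step0.
    rewrite /walk_mean/= /H /walk_step !mul0r !addr0 !mulN1r !mul1r.
    by field.
  apply: has_int_ext => w; rewrite goodS.
  rewrite (eq_bigr (fun v => (X1 w == c)%:R * good 1 w * fut i N e k w *
     ((eta i w == v)%:R * G (S i w) (X i w)))); last first.
    move=> v _; rewrite futS// -/i /i /= mulr1.
    have -> : (eta 2%N w == v)%:R * G (S 2%N w) (X 2%N w) =
      (eta 2%N w == v)%:R * H v (S 1%N w) (X 1%N w).
      case: eqP => [ev|]; last by rewrite !mul0r.
      rewrite /H /S erw_sumSS /X erw_lastSS ev /=.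
      by [].
    by ring.
  by rewrite /i /= !big_cons !big_nil; ring.
have i3 : (i <= 2)%N = false by rewrite /i !ltnS leqn0 (negbTE n0).
have n1 : (n.+1 == 1)%N = false by rewrite eqSS (negbTE n0).
(* On the event that [eta] is [v] and [K] is [m], this expresses [G] after the step through the
   state before it: [m = 1] recalls the first step, the other value the latest one. *)
pose H v m (s y : R) := if m == 1%N then G (s + v * x0) (v * x0) else G (s + v * y) (v * y).
have := has_int_sum vals (fun v => has_int_sum [:: 1%N; n.+1] (fun m => IH' v m (H v m))).
have -> : \sum_(v <- vals) \sum_(m <- [:: 1%N; n.+1]) pmf_step p q r c * U n.+1 (H v m) *
      futw n.+1 N (upd e i v) (upd k i m) = pmf_step p q r c * U i G * futw i N e k.
  rewrite !big_cons !big_nil !futwS// -/i i3 pmf_step1 pmf_stepN1 pmf_step0.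
  have -> : pmf_K R i 1 = 2^-1 by [].
  have -> : pmf_K R i n.+1 = 2^-1 by rewrite /pmf_K /i/= eqxx orbT.
  rewrite (walk_meanS p q r x0 G (ltn0Sn n)).
  have -> : U n.+1 (walk_step p q r x0 G) = U n.+1 (fun s y =>
     1 * (1 * (1 * (1 * (p / 2 * H 1 1%N s y + p / 2 * H 1 n.+1 s y) +
     q / 2 * H (-1) 1%N s y) + q / 2 * H (-1) n.+1 s y) + r / 2 * H 0 1%N s y)
     + r / 2 * H 0 n.+1 s y).
    congr (U _ _); apply/funext => s; apply/funext => y.
    by rewrite /walk_step /H eqxx n1 !mul1r !mul0r !mulN1r !addr0; field.
  by rewrite !walk_mean_lin; ring.
apply: has_int_ext => w; rewrite goodS.
rewrite (eq_bigr (fun v => \sum_(m <- [:: 1%N; n.+1])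
   (X1 w == c)%:R * good n.+1 w * fut i N e k w *
     ((eta i w == v)%:R * (K i w == m)%:R * G (S i w) (X i w)))); last first.
  move=> v _; apply: eq_big_seq => m mi; rewrite futS// -/i i3.
  have -> : (eta i w == v)%:R * (K i w == m)%:R * G (S i w) (X i w) =
      (eta i w == v)%:R * (K i w == m)%:R * H v m (S n.+1 w) (X n.+1 w).
    case: eqP => [ev|]; last by rewrite !mul0r.
    case: eqP => [km|]; last by rewrite !(mul0r, mulr0).
    rewrite /H /S erw_sumSS /X erw_lastSS ev km (negbTE n0).
    move: mi; rewrite !inE => /orP[] /eqP ->; first by rewrite eqxx nth0_erw_path.
    by rewrite n1.
  by ring.
by rewrite i3 /= !big_cons !big_nil; ring.
Qed.

End start.

Let sum_eq_mem (A : eqType) (s : seq A) (x : A) : uniq s ->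
  \sum_(v <- s) (x == v)%:R = (x \in s)%:R :> R.
Proof.
elim: s => [|v s IH] /=; first by rewrite big_nil.
move=> /andP[vs us]; rewrite big_cons IH// in_cons.
by case: eqVneq => [->|_]; rewrite ?(negbTE vs) ?addr0 ?add0r.
Qed.

Let uniq_vals : uniq vals.
Proof.
rewrite /= !inE !negb_or oner_eq0 oppr_eq0 oner_eq0 !andbT.
by rewrite -addr_eq0 (pnatr_eq0 _ 2).
Qed.

Let good01 n w : exists b : bool, good n w = b%:R.
Proof.
rewrite /good; elim/big_ind: _ => [|x y [b1 ->] [b2 ->]|i _]; first by exists true.
  by exists (b1 && b2); case: b1; rewrite ?mul1r ?mul0r.
rewrite sum_eq_mem//; case: leqP => i2; first by exists (eta i w \in vals); rewrite mulr1.
rewrite sum_eq_mem; last by rewrite /= inE andbT; case: i i2 => [|[|[|]]].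
exists ((eta i w \in vals) && (K i w \in [:: 1%N; i.-1])).
by case: (eta i w \in vals); rewrite ?mul1r ?mul0r.
Qed.

Hypothesis pqr : p + q + r = 1.

Let fut0 n e k w : fut n n e k w = 1. Proof. by rewrite /fut big_geq. Qed.
Let futw0 n e k : futw n n e k = 1. Proof. by rewrite /futw big_geq. Qed.

Let walk_law0 c x0 n G : (0 < n)%N ->
  has_int P (fun w => (X1 w == c)%:R * good n w *
      G (erw_sum x0 (eta ^~ w) (K ^~ w) n))
    (pmf_step p q r c * walk_mean p q r x0 n (fun s _ => G s)).
Proof.
move=> n0.
have := @walk_law c x0 n n (fun=> 0) (fun=> 0%N) (fun s _ => G s).
rewrite n0 leqnn futw0 mulr1 => /(_ isT); apply: has_int_ext => w.
by rewrite fut0 mulr1.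
Qed.

Let allgood n w : R := \sum_(c <- vals) (X1 w == c)%:R * good n w.

(** By [walk_law] with the constant 1, the admissible values carry total mass [p + q + r = 1]; a
    function bounded by 1 with integral 1 is almost everywhere 1. *)
Let allgood_ae n : (0 < n)%N -> ae_eq P setT (EFin \o allgood n) (cst 1%E).
Proof.
move=> n0.
have i1 : has_int P (fun w => 1 - allgood n w) 0.
  have e0 : 1 - \sum_(c <- vals) pmf_step p q r c * walk_mean p q r 0 n (fun _ _ => 1) = 0.
    rewrite !big_cons big_nil pmf_step1 pmf_stepN1 pmf_step0 walk_mean_cst//.
    by rewrite !mulr1 addr0 addrA pqr subrr.
  rewrite -e0; apply: (@has_intB _ _ _ _ (cst 1)).
    split; first exact: finite_measure_integrable_cst.
    by rewrite -[LHS]/(\int[P]_x cst 1%E x)%E integral_cst// mul1e [LHS]probability_setT.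
  apply: has_int_sum => c.
  by apply: has_int_ext (@walk_law0 c 0 n (fun=> 1) n0) => w; rewrite mulr1.
have g01 w : 0 <= 1 - allgood n w.
  rewrite /allgood -mulr_suml sum_eq_mem//; have [b ->] := good01 n w.
  by rewrite subr_ge0; case: (_ \in _); case: b; rewrite ?mul1r ?mul0r ?mulr0.
have [/integrableP[mi _] i0] := i1.
have : ae_eq P setT (EFin \o (fun w => 1 - allgood n w)) (cst 0%E).
  apply/ae_eq_integral_abs => //; rewrite -[RHS]i0.
  by apply: eq_integral => w _ /=; rewrite ger0_norm.
apply: filterS => w /(_ I) /= -[/eqP]; rewrite subr_eq0 => /eqP <- _.
by [].
Qed.

(** Split by the value of [X1] and discard the null set where [allgood] is not 1. The map [x0] is
    the identity for [S_n] and constant for [T_n]. *)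
Lemma law_int n (h : T -> R) (x0 : R -> R) (G : R -> R -> R) : (0 < n)%N ->
  measurable_fun setT h ->
  (forall w, h w = G (X1 w) (erw_sum (x0 (X1 w)) (eta ^~ w) (K ^~ w) n)) ->
  has_int P h
    (p * walk_mean p q r (x0 1) n (fun s _ => G 1 s) +
     q * walk_mean p q r (x0 (-1)) n (fun s _ => G (-1) s) +
     r * walk_mean p q r (x0 0) n (fun s _ => G 0 s)).
Proof.
move=> n0 mh hG.
have i1 := has_int_sum vals (fun c => @walk_law0 c (x0 c) n (G c) n0).
rewrite !big_cons big_nil pmf_step1 pmf_stepN1 pmf_step0 addr0 addrA in i1.
have {}i1 : has_int P (fun w => h w * allgood n w)
    (p * walk_mean p q r (x0 1) n (fun s _ => G 1 s) +
     q * walk_mean p q r (x0 (-1)) n (fun s _ => G (-1) s) +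
     r * walk_mean p q r (x0 0) n (fun s _ => G 0 s)).
  apply: has_int_ext i1 => w; rewrite /allgood mulr_sumr; apply: eq_bigr => c _.
  case: eqP => [<-|_]; last by rewrite !mul0r mulr0.
  by rewrite hG mulrC.
have [/integrableP[mi foo] iv] := i1.
have ae : ae_eq P setT (EFin \o h) (EFin \o (fun w => h w * allgood n w)).
  apply: filterS (allgood_ae n0) => w /= /(_ I) [->] _.
  by rewrite mulr1.
have mh' : measurable_fun setT (EFin \o h) by exact/measurable_EFinP.
split.
  apply/integrableP; split=> //.
  rewrite (@ae_eq_integral _ _ _ P _ (abse \o (EFin \o (fun w => h w * allgood n w))))//.
  - exact: measurableT_comp.
  - exact: measurableT_comp.
  - exact: ae_eq_abse.
by rewrite -iv; exact: ae_eq_integral.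
Qed.

End joint_law.

(** When both remembered steps are 0, every transition leaves the state unchanged. *)
Lemma walk_mean_start0 (R : realType) (p q r : R) n G : p + q + r = 1 ->
  walk_mean p q r 0 n G = G 0 0.
Proof.
move=> pqr; have rE : r = 1 - p - q by lra.
have st H s : walk_step p q r 0 H s 0 = H s 0.
  by rewrite /walk_step subr0 addr0 oppr0 rE; field.
rewrite /walk_mean; suff h k s : iter k (walk_step p q r 0) G s 0 = G s 0 by exact: h.
by elim: k s => // k IH s; rewrite iterS st IH.
Qed.

Unset Implicit Arguments.
Set Strict Implicit.

Theorem theorem8p2 (R : realType) (d : measure_display) (T : measurableType d)
  (P : probability T R) (p q r : R)
  (X1 : T -> R) (eta : nat -> T -> R) (K : nat -> T -> nat) :
  0 < p < 1 -> 0 < q < 1 -> 0 < r < 1 -> p + q + r = 1 ->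
  measurable_fun setT X1 ->
  (forall i, measurable_fun setT (eta i)) ->
  (forall j m, measurable [set w | K j w = m]) ->
  (* independence of X1, eta_2, eta_3, ..., K_3, K_4, ... together with their
     laws, expressed through the joint probability mass function of every
     finite initial segment of the family *)
  (forall (n : nat) (x1 : R) (e : nat -> R) (k : nat -> nat),
      P [set w | X1 w = x1 /\ (forall i, (2 <= i <= n)%N -> eta i w = e i)
                 /\ (forall j, (3 <= j <= n)%N -> K j w = k j)]
      = (pmf_step p q r x1 * \prod_(2 <= i < n.+1) pmf_step p q r (e i)
         * \prod_(3 <= j < n.+1) pmf_K R j (k j))%:E) ->
  let S := fun n w => erw_sum (X1 w) (eta ^~ w) (K ^~ w) n in
  let Tn := fun n w => erw_sum 1 (eta ^~ w) (K ^~ w) n in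
  exists sigmaT2 : R,
    (fun n : nat => fine ('V_P[Tn n]) / n%:R) @ \oo --> sigmaT2 /\
    let F := fun x : R =>
      (p + q) * normal_cdf sigmaT2 x + r * (if 0 <= x then 1 else 0) in
    forall x : R, {for x, continuous F} ->
      (fun n : nat =>
         P [set w | (S n w - n%:R * ((p - q) * X1 w / (2 + q - p)))
                      / Num.sqrt n%:R <= x])
      @ \oo --> (F x)%:E.
Proof.
move=> /andP[p0 _] /andP[q0 _] /andP[r0 _] pqr mX1 meta mK law S Tn.
exists (lim_var p q); split.
  have mT n : measurable_fun setT (Tn n).
    exact: (measurable_erw_sum meta mK n (measurable_cst (1 : R))).
  have m1 n : (0 < n)%N -> has_int P (Tn n) (walk_mean p q r 1 n (fun s _ => s)).
    move=> n0.
    have := law_int mX1 meta mK law pqr n0 (mT n) (x0 := fun=> 1) (G := fun _ s => s)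
      (fun=> erefl).
    (* [T_n] starts from 1 whatever [X1] is, so the three conditional means coincide and their
       weights add up to 1. *)
    by rewrite -!mulrDl pqr mul1r.
  have m2 n : (0 < n)%N ->
      has_int P (fun w => Tn n w * Tn n w) (walk_mean p q r 1 n (fun s _ => s ^+ 2)).
    move=> n0.
    have := law_int mX1 meta mK law pqr n0 (measurable_funM (mT n) (mT n))
      (x0 := fun=> 1) (G := fun _ s => s ^+ 2) (fun=> erefl).
    by rewrite -!mulrDl pqr mul1r.
  have [C HC] := walk_variance p0 q0 r0 pqr (or_introl erefl).
  pose a := 1 - (p - q) / 2.
  have a0 : 0 < a ^+ 2 by rewrite exprn_gt0// /a; lra.
  apply/cvgrPdist_le => e e0; near=> n.
  have n0 : (0 < n)%N by near: n; exact: nbhs_infty_gt.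
  have nn : 0 < n%:R :> R by rewrite ltr0n.
  have [i1 v1] := m1 n n0; have [i2 v2] := m2 n n0.
  have -> : fine 'V_P[Tn n] = walk_mean p q r 1 n (fun s _ => s ^+ 2)
      - walk_mean p q r 1 n (fun s _ => s) ^+ 2.
    rewrite /variance covarianceE; try exact/Lfun1_integrable.
    by rewrite unlock v1 [X in (X - _)%E]v2 -EFinM -EFinB/= expr2.
  move: (HC n n0); set v := _ - _ ^+ 2 => hv.
  rewrite distrC.
  have -> : v / n%:R - lim_var p q =
     (a ^+ 2 * v - asym_var p q * n%:R) / (a ^+ 2 * n%:R).
    by rewrite /lim_var -/a; field; rewrite !gt_eqF// /a; lra.
  rewrite normrM [X in _ * X]ger0_norm; last by rewrite invr_ge0 mulr_ge0// ltW.
  apply: le_trans (ler_wpM2r _ hv) _; first by rewrite invr_ge0 mulr_ge0// ltW.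
  have an0 : 0 < a ^+ 2 * n%:R by exact: mulr_gt0.
  have ea0 : 0 < e * a ^+ 2 by exact: mulr_gt0.
  rewrite ler_pdivrMr// mulrA -ler_pdivrMl//.
  by near: n; exact: nbhs_infty_ger.
move=> F x _.
pose B n := [set w | (S n w - n%:R * ((p - q) * X1 w / (2 + q - p))) / Num.sqrt n%:R <= x].
pose u n (c : R) := walk_mean p q r c n (fun s _ =>
     ((s - n%:R * ((p - q) * c / (2 + q - p))) / Num.sqrt n%:R <= x)%R%:R).
have PB n : (0 < n)%N ->
    P (B n) = (p * u n 1 + q * u n (-1) + r * (if 0 <= x then 1 else 0))%:E.
  move=> n0.
  have mB : measurable (B n).
    rewrite /B -[X in measurable X]setTI.
    apply: measurable_fun_le => //.
    apply: measurable_funM => //; apply: measurable_funB.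
      exact: measurable_erw_sum.
    by apply: measurable_funM => //; apply: measurable_funM => //; exact: measurable_funM.
  have := law_int mX1 meta mK law pqr n0 (measurable_indic mB)
    (x0 := id) (G := fun c s =>
     ((s - n%:R * ((p - q) * c / (2 + q - p))) / Num.sqrt n%:R <= x)%R%:R).
  case.
    by move=> w; rewrite indicE; congr (nat_of_bool _)%:R; apply/idP/idP; rewrite inE.
  move=> _; rewrite integral_indic// setIT => ->.
  (* On [X1 = 0] the normalised sum is 0, so its indicator reduces to that of [0 <= x]: the atom of
     the mixture. *)
  rewrite (walk_mean_start0 _ _ pqr) mulr0 mul0r mulr0 subrr mul0r.
  by congr ((_ + _ * _)%:E); case: (0 <= x).
apply: (@cvg_trans _ ((fun n => (p * u n 1 + q * u n (-1) +
    r * (if 0 <= x then 1 else 0))%:E) @ \oo)).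
  apply: near_eq_cvg; near=> n; rewrite -PB//.
  by near: n; exact: nbhs_infty_gt.
apply: cvg_EFin; first by near=> n.
(* The starts 1 and -1 have the same limit law, since [lim_var] does not depend on the start;
   together they carry the mass [p + q]. *)
rewrite /F mulrDl; apply: cvgD; last exact: cvg_cst.
apply: cvgD; apply: cvgM; try exact: cvg_cst.
- by apply: walk_clt => //; left.
- by apply: walk_clt => //; right.
Unshelve. all: by end_near. Qed.
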